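(* Let $t\in[0,1)$, $n\ge1$ and $a_1,\dots,a_n\in(0,1)$. Let $\varnothing=\lambda^{(0)}\subset\lambda^{(1)}\subset\cdots\subset\lambda^{(n)}$ be random partitions distributed according to the ascending half-space Hall–Littlewood process $$\mathbb{P}^{\rm HL}\left(\varnothing=\lambda^{(0)}\subset\lambda^{(1)}\subset\cdots\subset\lambda^{(n)}=\lambda\right)=\frac{P_{\lambda^{(1)}/\lambda^{(0)}}(a_1)\cdots P_{\lambda^{(n)}/\lambda^{(n-1)}}(a_n)}{\Phi(a_1,\dots,a_n)}\;b^{\rm el}_\lambda\;\mathbf 1_{\lambda'\text{ even}},$$ and let $$[\lambda^{(1)}\subset\cdots\subset\lambda^{(n)}]:=\Big(\ell(\lambda^{(i)})-\ell(\lambda^{(i-1)})\Big)_{1\le i\le n}.$$ Let $\sigma_n(\mathcal C)\in\{0,1\}^n$ be the $n$-th path string of a configuration $\mathcal C$ of the stochastic six-vertex model in the half-quadrant with parameters $t$ and $a_1,\dots,a_n$. Then for every $(s_1,\dots,s_n)\in\{0,1\}^n$, $$\mathbb{P}^{\rm HL}\left([\lambda^{(1)}\subset\cdots\subset\lambda^{(n)}]=(s_1,\dots,s_n)\right)=\mathbb P\Big[\sigma_n(\mathcal C)=(s_1,\dots,s_n)\Big].$$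
   Context: **Partitions and Hall–Littlewood functions.** $\ell(\lambda)$ is the length of $\lambda$, $m_i(\lambda)$ is the multiplicity of the part $i$, and $\lambda'$ is the transpose. ''$\lambda'$ even'' means all parts of $\lambda'$ are even, equivalently all $m_i(\lambda)$ are even. $P_{\lambda/\mu}(a)$ is the skew Hall–Littlewood $P$-function with parameter $t$ (skew Macdonald function at $q=0$) in a single variable $a$. For $\lambda'$ even, $b^{\rm el}_\lambda=\prod_{i\ge1}\prod_{k=1}^{m_i(\lambda)/2}(1-t^{2k-1})$. Finally $\Phi(a_1,\dots,a_n)=\prod_{1\le i<j\le n}\frac{1-ta_ia_j}{1-a_ia_j}$. **Stochastic six-vertex model in the half-quadrant.** Sites are $(x,y)\in\mathbb Z_{>0}^2$ with $x\le y$. Each edge carries a state in $\{0,1\}$ ($1$ = occupied by an up-right path). The east edge of $(x,y)$ is the west edge of $(x+1,y)$, and the north edge of $(x,y)$ is the south edge of $(x,y+1)$. The west edge of $(1,y)$ is occupied for every $y\ge1$. The configuration is sampled in a Markovian way, successively on the diagonals $x+y=2,3,\dots$, independently at each vertex given its incoming edges. - At a bulk vertex $(x,y)$, $x<y$, write (west, south) for the incoming states and (east, north) for the outgoing states. Then: - $(0,0)\to(0,0)$ with probability $1$. - $(1,1)\to(1,1)$ with probability $1$. - $(1,0)\to(1,0)$ with probability $\frac{1-a_xa_y}{1-ta_xa_y}$. - $(1,0)\to(0,1)$ with probability $\frac{(1-t)a_xa_y}{1-ta_xa_y}$. - $(0,1)\to(0,1)$ with probability $\frac{t(1-a_xa_y)}{1-ta_xa_y}$.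 - $(0,1)\to(1,0)$ with probability $\frac{1-t}{1-ta_xa_y}$. - At a corner vertex $(x,x)$, which has only a west (incoming) and a north (outgoing) edge, the north state equals $1$ minus the west state. The $n$-th path string is $\sigma_n(\mathcal C)=(s_1,\dots,s_n)$, where $s_k$ is the state of the north edge of $(k,n)$. *)

(* Defs.v *)
From HB Require Import structures.
From mathcomp Require Import all_boot all_order all_algebra all_fingroup.
From mathcomp Require Import all_classical all_reals all_analysis.

Set Implicit Arguments.
Unset Strict Implicit.
Unset Printing Implicit Defensive.
Import Order.TTheory GRing.Theory Num.Theory.

Local Open Scope classical_set_scope.
Local Open Scope ring_scope.

(** * Integer partitions *)

Record intpart := IntPart {
  parts :> seq nat;
  _ : sorted geq parts && (0%N \notin parts) }.

HB.instance Definition _ := [isSub for parts].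
HB.instance Definition _ := [Countable of intpart by <:].

Definition empty_part : intpart := @IntPart [::] isT.

(* The i-th largest part, counted from 0, and 0 beyond the length. *)
Definition part (lam : intpart) (i : nat) : nat := nth 0%N lam i.

Definition len (lam : intpart) : nat := size lam.

Definition mult (lam : intpart) (i : nat) : nat := count_mem i lam.

Definition included (mu lam : intpart) : Prop :=
  forall i, (part mu i <= part lam i)%N.

Definition transpose (lam : intpart) : seq nat :=
  [seq count (leq j) lam | j <- iota 1 (part lam 0)].

Definition transpose_even (lam : intpart) : bool :=
  all (fun p => ~~ odd p) (transpose lam).

(** * Hall-Littlewood functions *)

Section HallLittlewood.
Context {R : realType}.
Implicit Types (t a : R) (lam mu : intpart) (x : seq R).

Definition vfac t (m : nat) : R :=
  \prod_(1 <= i < m.+1) ((1 - t ^+ i) / (1 - t)).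

(* v_lam(t) for lam regarded as a partition with n parts, so that 0 has
   multiplicity n - len lam; parts exceeding the largest one contribute 1. *)
Definition vpart t (n : nat) lam : R :=
  vfac t (n - len lam) * \prod_(1 <= i < (part lam 0).+1) vfac t (mult lam i).

(* The Hall-Littlewood polynomial P_lam(x_1, ..., x_n; t) (Macdonald,
   "Symmetric Functions and Hall Polynomials", III.2), evaluated at x; it is 0
   if lam has more than n parts.  The symmetrization formula makes sense
   only at points with pairwise distinct coordinates. *)
Definition HL_P t lam x : R :=
  if (len lam <= size x)%N then
    (\sum_(w : 'S_(size x))
       (\prod_(i < size x) x`_(w i) ^+ part lam i) *
       (\prod_(p : 'I_(size x) * 'I_(size x) | (p.1 < p.2)%N)
          ((x`_(w p.1) - t * x`_(w p.2)) / (x`_(w p.1) - x`_(w p.2)))))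
    / vpart t (size x) lam
  else 0.

(* P_lam(x, a) = \sum_mu c_mu P_mu(x) as symmetric functions of x, i.e. in any
   number of variables.  A polynomial identity may be tested on points with
   pairwise distinct coordinates. *)
Definition skew_expansion t lam a (c : intpart -> R) : Prop :=
  finite_set [set mu | c mu != 0] /\
  forall x, uniq (rcons x a) ->
    HL_P t lam (rcons x a) = \sum_(mu \in [set: intpart]) c mu * HL_P t mu x.

(* P_{lam/mu}(a): the coefficient of P_mu(x) in P_lam(x, a)
   (Macdonald, III (5.5') and VI (7.9')); the expansion is unique because
   the P_mu form a basis of the ring of symmetric functions. *)
Definition HL_skewP t lam mu a : R :=
  xget (fun=> 0) [set c | skew_expansion t lam a c] mu.

Definition b_el t lam : R :=
  \prod_(1 <= i < (part lam 0).+1)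
    \prod_(1 <= k < ((mult lam i)./2).+1) (1 - t ^+ (k.*2.-1)).

Definition Phi t (n : nat) (a : 'I_n -> R) : R :=
  \prod_(p : 'I_n * 'I_n | (p.1 < p.2)%N)
    ((1 - t * a p.1 * a p.2) / (1 - a p.1 * a p.2)).

End HallLittlewood.

(** * The ascending half-space Hall-Littlewood process *)

Definition chain (n : nat) := {ffun 'I_n.+1 -> intpart}.

Definition ascending (n : nat) (lam : chain n) : Prop :=
  lam ord0 = empty_part /\
  forall i : 'I_n, included (lam (inord i)) (lam (inord i.+1)).

Definition HL_mass (R : realType) (t : R) (n : nat) (a : 'I_n -> R)
    (lam : chain n) : R :=
  (\prod_(i < n) HL_skewP t (lam (inord i.+1)) (lam (inord i)) (a i))
  / Phi t a * b_el t (lam ord_max) * (transpose_even (lam ord_max))%:R.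

Definition HL_prob (R : realType) (t : R) (n : nat) (a : 'I_n -> R)
    (A : set (chain n)) : \bar R :=
  \esum_(lam in [set lam | ascending lam /\ A lam]) (HL_mass t a lam)%:E.

(* On ascending chains the truncated subtraction is an honest one. *)
Definition length_increments (n : nat) (lam : chain n) : {ffun 'I_n -> nat} :=
  [ffun i : 'I_n => (len (lam (inord i.+1)) - len (lam (inord i)))%N].

(** * The stochastic six-vertex model in the half-quadrant *)

(* Coordinates are counted from 0: the vertex (x, y) below, x <= y < n, is the
   site (x+1, y+1).  Only these sites influence the n-th path string.  A
   configuration gives the states (east, north) of the outgoing edges of each
   vertex; absent edges (all edges at x > y, and the east edge at a corner)
   are required to carry the state false. *)
Definition config (n : nat) := {ffun 'I_n * 'I_n -> bool * bool}.

Section SixVertex.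
Variable n : nat.
Implicit Type C : config n.

Definition well_formed C : bool :=
  [forall v : 'I_n * 'I_n, ((v.2 <= v.1)%N ==> ~~ (C v).1) &&
                           ((v.2 < v.1)%N ==> ~~ (C v).2)].

Definition outgoing C (x y : nat) : bool * bool :=
  match insub x, insub y with
  | Some i, Some j => C (i, j)
  | _, _ => (false, false)
  end.

Definition east C (x y : nat) : bool := (outgoing C x y).1.
Definition north C (x y : nat) : bool := (outgoing C x y).2.

Definition west C (x y : nat) : bool :=
  if x is x'.+1 then east C x' y else true.

(* Used at bulk vertices only, where 0 <= x < y. *)
Definition south C (x y : nat) : bool := north C x y.-1.

Definition path_string C : {ffun 'I_n -> bool} := [ffun k : 'I_n => north C k n.-1].

Context {R : realType}.

(* The probability of (w, s) -> (e, h), (west, south) to (east, north), at a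
   bulk vertex with u = a_x a_y. *)
Definition bulk_weight (t u : R) (w s e h : bool) : R :=
  match w, s, e, h with
  | false, false, false, false => 1
  | true,  true,  true,  true  => 1
  | true,  false, true,  false => (1 - u) / (1 - t * u)
  | true,  false, false, true  => (1 - t) * u / (1 - t * u)
  | false, true,  false, true  => t * (1 - u) / (1 - t * u)
  | false, true,  true,  false => (1 - t) / (1 - t * u)
  | _, _, _, _ => 0
  end.

Definition corner_weight (w h : bool) : R := (h == ~~ w)%:R.

(* The probability of a configuration under the diagonal-by-diagonal sampling
   is the product, over all vertices, of the conditional probability of its
   outgoing edges given its incoming ones. *)
Definition config_weight (t : R) (a : 'I_n -> R) C : R :=
  (\prod_(v : 'I_n * 'I_n | (v.1 < v.2)%N)
     bulk_weight t (a v.1 * a v.2) (west C v.1 v.2) (south C v.1 v.2)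
                                   (east C v.1 v.2) (north C v.1 v.2)) *
  (\prod_(x < n) corner_weight (west C x x) (north C x x)).

Definition sixvertex_prob (t : R) (a : 'I_n -> R) (A : pred (config n)) : R :=
  \sum_(C : config n | well_formed C && A C) config_weight t a C.

End SixVertex.

(* Main.v *)
(* Record a chain of partitions by its columns: column j gives the string of
   bits telling which steps of the chain add a box to it.  The weight of a chain
   is then a product over columns, and the strings of successive columns, read
   from right to left, evolve by a transfer matrix K acting on {0,1}^n (one
   column of t-bosons).  K is triangular with diagonal entries
   \prod_i a_i^(s_i), so up to scaling it has a unique fixed vector, and summing
   over all chains computes that vector.  On the other side, the path strings of
   the six-vertex model evolve by adding a row.  The Yang-Baxter equation,
   together with a reflection identity for b^el at the corner, shows that adding
   a row intertwines the matrices K of sizes n and n + 1; since the incoming west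
   edge is occupied and the boson column starts empty, the vector of path string
   probabilities is fixed by K.  It is normalized by the probability 1 / Phi of
   the empty string.

   The explicit one-variable skew functions, needed to write K, come from the
   recursion P_lam(X) = \sum_(I : |I| = len lam) x_I P_(lam^-)(x_I)
   \prod_(i in I, j notin I) (x_i - t x_j) / (x_i - x_j), where lam^- is lam
   without its first column, and from partial fractions in the last variable. *)

Require Import Defs.
From HB Require Import structures.
From mathcomp Require Import all_boot all_order all_algebra all_fingroup.
From mathcomp Require Import ring zify.

Set Implicit Arguments.
Unset Strict Implicit.
Unset Printing Implicit Defensive.
Import Order.TTheory GRing.Theory Num.Theory.

Local Open Scope ring_scope.

(** * The branching rule *)

(** [HL_skewP] is picked by [xget] among all expansions, so explicit coefficients determine it only
    once the expansion is known to be unique. The polynomials [HL_P] are given by a symmetrization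
    that is meaningful only at pairwise distinct coordinates, which must also differ from the last
    variable [a]. Linear independence is therefore proved by evaluation at points avoiding a finite
    list of values, with a polynomial argument in one variable at a time. The subset recursion makes
    sense for any finite set of variables and has the columns as its data, so the branching rule
    comes out column by column, as K needs it.

    There are infinitely many chains, so the fixed vector is reached as a limit over the number of
    columns. All entries of K are nonnegative and its entry at the pair of empty strings is 1; hence
    iterating K on the indicator of the empty string gives an increasing sequence. The path string
    vector, divided by its entry at the empty string, bounds this sequence, being fixed and
    nonnegative. The limit is again fixed with entry 1 at the empty string, which leaves only one
    possibility. *)

Fixpoint sumbits (R : zmodType) (n : nat) (F : seq bool -> R) : R :=
  if n is n'.+1 then
    sumbits n' (fun s => F (false :: s)) + sumbits n' (fun s => F (true :: s))
  else F [::].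

Lemma eq_sumbits (R : zmodType) n (F G : seq bool -> R) :
  (forall s, size s = n -> F s = G s) -> sumbits n F = sumbits n G.
Proof.
elim: n F G => [|n IH] F G FG /=; first exact: FG.
by congr (_ + _); apply: IH => s sn; apply: FG; rewrite /= sn.
Qed.

Lemma sumbitsD (R : zmodType) n (F G : seq bool -> R) :
  sumbits n (fun s => F s + G s) = sumbits n F + sumbits n G.
Proof. by elim: n F G => [//|n IH] F G /=; rewrite !IH addrACA. Qed.

Lemma sumbits0 (R : zmodType) n : sumbits n (fun _ => 0 : R) = 0.
Proof. by elim: n => [//|n /= ->]; rewrite addr0. Qed.

Lemma mulr_sumbits (R : pzRingType) n (c : R) (F : seq bool -> R) :
  c * sumbits n F = sumbits n (fun s => c * F s).
Proof. by elim: n F => [//|n IH] F /=; rewrite mulrDr !IH. Qed.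

Lemma mulr_sumbitsl (R : pzRingType) n (c : R) (F : seq bool -> R) :
  sumbits n F * c = sumbits n (fun s => F s * c).
Proof. by elim: n F => [//|n IH] F /=; rewrite mulrDl !IH. Qed.

Lemma sumbits_sum (R : zmodType) n (I : Type) (r : seq I) (P : pred I)
    (F : I -> seq bool -> R) :
  \sum_(i <- r | P i) sumbits n (F i)
  = sumbits n (fun s => \sum_(i <- r | P i) F i s).
Proof.
by elim: n F => [//|n IH] F /=; rewrite big_split /= !IH.
Qed.

Lemma sumbitsB (R : zmodType) n (F G : seq bool -> R) :
  sumbits n (fun s => F s - G s) = sumbits n F - sumbits n G.
Proof.
by elim: n F G => [//|n IH] F G /=; rewrite !IH opprD addrACA.
Qed.

(** * Subset recursion over the columns and identities in the variables *)

Section ColumnPolynomials.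
Variables (R : fieldType) (V : finType) (t : R) (x : V -> R).
Hypothesis x_inj : injective x.
Implicit Types (A B I : {set V}) (cs : seq nat) (ss : seq bool).

Definition hl (i j : V) : R := (x i - t * x j) / (x i - x j).
Definition hlprod B A : R := \prod_(b in B) \prod_(c in A) hl b c.
Definition qint (n : nat) : R := \sum_(i < n) t ^+ i.

(* [cs] lists the columns of the partition: the recursion removes the first one. *)
Fixpoint colpoly cs A : R :=
  if cs is c :: cs' then
    \sum_(B : {set V} | (B \subset A) && (#|B| == c))
      (\prod_(b in B) x b) * colpoly cs' B * hlprod B (A :\: B)
  else 1.

Lemma xsub_neq0 i j : i != j -> x i - x j != 0.
Proof. by rewrite subr_eq0 (inj_eq x_inj). Qed.

Lemma qintS n : qint n.+1 = 1 + t * qint n.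
Proof.
rewrite /qint big_ord_recl expr0 mulr_sumr; congr (_ + _).
by apply: eq_bigr => i _; rewrite exprS.
Qed.

Lemma qintE n : (1 - t) * qint n = 1 - t ^+ n.
Proof.
elim: n => [|n IH]; first by rewrite /qint big_ord0 mulr0 expr0 subrr.
rewrite qintS mulrDr mulr1 mulrCA IH exprS; ring.
Qed.

(** Partial fractions in [x a]: the product tends to 1 at infinity and has simple poles at the
    [x j], with residue [(1 - t) * x j] times the remaining factors at [j]. Induction on the size of
    [A], splitting off one factor, avoids rational functions. *)
Lemma partial_fractions a A : a \notin A ->
  \prod_(j in A) hl a j =
  1 + \sum_(j in A) (1 - t) * x j / (x a - x j) * \prod_(k in A :\ j) hl j k.
Proof.
elim: {A}#|A| {-2}A (erefl #|A|) a => [|n IH] A cA a aA.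
  have -> : A = set0 by apply: cards0_eq.
  by rewrite !big_set0 addr0.
have [l lA] : exists l, l \in A by apply/set0Pn; rewrite -card_gt0 cA.
have al : a != l by apply: contraNneq aA => ->.
have [xal] := xsub_neq0 al.
have cA' : #|A :\ l| = n by move: cA; rewrite (cardsD1 l) lA => -[].
have aA' : a \notin A :\ l by rewrite inE negb_and aA orbT.
have lA' : l \notin A :\ l by rewrite !inE eqxx.
rewrite (big_setD1 l) //= (big_setD1 l lA) /= !(IH _ cA') //.
have -> : hl a l = 1 + (1 - t) * x l / (x a - x l) by rewrite /hl; field.
rewrite mulrDl mul1r -addrA; congr (1 + _).
rewrite mulrDr mulr1 addrCA addrA; rewrite mulrDr mulr1 -!addrA; congr (_ + _).
rewrite !mulr_sumr addrC -!big_split /=; apply: eq_bigr => j.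
rewrite !inE => /andP[jl jA].
have aj : a != j by apply: contraNneq aA => ->.
have xaj := xsub_neq0 aj; have xjl := xsub_neq0 jl.
have xlj : x l - x j != 0 by rewrite -opprB oppr_eq0.
have lj : l \in A :\ j by rewrite !inE eq_sym jl.
rewrite [in RHS](big_setD1 l lj) /=.
have -> : A :\ l :\ j = A :\ j :\ l.
  by apply/setP => z; rewrite !inE; do !case: eqP.
by rewrite /hl; field; rewrite xal xaj xlj xjl.
Qed.

(** Here the factors have their arguments swapped and the limit at infinity is a power of [t]. The
    expansion is normalized at [x a = 0] instead, where the product is 1; this is why [x a] and not
    [x j] stands in the numerators. *)
Lemma partial_fractions_op a A : a \notin A ->
  \prod_(j in A) hl j a =
  1 - \sum_(j in A) (1 - t) * x a / (x a - x j) * \prod_(k in A :\ j) hl k j.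
Proof.
elim: {A}#|A| {-2}A (erefl #|A|) a => [|n IH] A cA a aA.
  have -> : A = set0 by apply: cards0_eq.
  by rewrite !big_set0 subr0.
have [l lA] : exists l, l \in A by apply/set0Pn; rewrite -card_gt0 cA.
have al : a != l by apply: contraNneq aA => ->.
have [xal] := xsub_neq0 al.
have xla : x l - x a != 0 by rewrite -opprB oppr_eq0.
have cA' : #|A :\ l| = n by move: cA; rewrite (cardsD1 l) lA => -[].
have aA' : a \notin A :\ l by rewrite inE negb_and aA orbT.
have lA' : l \notin A :\ l by rewrite !inE eqxx.
rewrite (big_setD1 l) //= (big_setD1 l lA) /= !(IH _ cA') //.
have -> : hl l a = 1 - (1 - t) * x a / (x a - x l).
  by rewrite /hl; field; rewrite xal xla.
set q := (1 - t) * x a / (x a - x l).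
set S1 := \sum_(j in A :\ l) _; set S2 := \sum_(j in A :\ l) _.
set S3 := \sum_(j in A :\ l) _.
suff -> : S3 = (1 - q) * S1 + q * S2 by ring.
rewrite /S1 /S2 /S3 !mulr_sumr -big_split /=; apply: eq_bigr => j.
rewrite !inE => /andP[jl jA].
have aj : a != j by apply: contraNneq aA => ->.
have xaj := xsub_neq0 aj; have xjl := xsub_neq0 jl.
have xlj : x l - x j != 0 by rewrite -opprB oppr_eq0.
have lj : l \in A :\ j by rewrite !inE eq_sym jl.
rewrite [in LHS](big_setD1 l lj) /=.
have -> : A :\ l :\ j = A :\ j :\ l.
  by apply/setP => z; rewrite !inE; do !case: eqP.
by rewrite /q /hl; field; rewrite ?xal xaj xlj.
Qed.

(** Expanding the term of one variable [a] by partial fractions leaves 1, and its pole at [j]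
    combines with the factor [hl a j] of the [j]-th term:
    [hl a j - (1 - t) * x a / (x a - x j) = t]. So the sum satisfies the recursion of [qint]. *)
Lemma sum_hl_deletion A : \sum_(y in A) \prod_(z in A :\ y) hl z y = qint #|A|.
Proof.
elim: {A}#|A| {-2}A (erefl #|A|) => [|n IH] A cA.
  have -> : A = set0 by apply: cards0_eq.
  by rewrite big_set0 cards0 /qint big_ord0.
have [a aA] : exists a, a \in A by apply/set0Pn; rewrite -card_gt0 cA.
have cA' : #|A :\ a| = n by move: cA; rewrite (cardsD1 a) aA => -[].
have aA' : a \notin A :\ a by rewrite !inE eqxx.
rewrite cA qintS -cA' -IH // (big_setD1 a aA) /= partial_fractions_op //.
rewrite -addrA; congr (1 + _); rewrite mulr_sumr -sumrN -big_split /=.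
apply: eq_bigr => j; rewrite !inE => /andP[ja jA].
have xaj : x a - x j != 0 by rewrite xsub_neq0 // eq_sym.
have aj : a \in A :\ j by rewrite !inE eq_sym ja.
rewrite [in LHS](big_setD1 a aj) /=.
have -> : A :\ j :\ a = A :\ a :\ j.
  by apply/setP => z; rewrite !inE; do !case: eqP.
by rewrite /hl; field.
Qed.

(** Exchange the sums over the deleted [y] and the subset [B], which must miss [y]. The factors
    [hl z y] with [z] in [B] complete [hlprod B (A :\: B)]; the others sum to a [qint] over
    [A :\: B]. The identity serves twice: for a part equal to 0 in the symmetrization, and for a
    full first column in the branching rule. *)
Lemma colpoly_deletion cs A :
  \sum_(y in A) (\prod_(z in A :\ y) hl z y) * colpoly cs (A :\ y)
  = qint (#|A| - head 0%N cs)%N * colpoly cs A.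
Proof.
case: cs => [|c cs] /=.
  rewrite subn0 mulr1 -sum_hl_deletion.
  by apply: eq_bigr => y _; rewrite mulr1.
under eq_bigr do rewrite mulr_sumr.
rewrite (exchange_big_dep (fun B : {set V} => (B \subset A) && (#|B| == c))) /=;
  last first.
  move=> y B yA /andP[BA ->]; rewrite andbT.
  exact: subset_trans BA (subD1set _ _).
rewrite mulr_sumr; apply: eq_bigr => B /andP[BA /eqP cB].
have cAB : #|A :\: B| = (#|A| - c)%N by rewrite cardsDS // cB.
rewrite -cAB -sum_hl_deletion mulr_suml.
rewrite (eq_bigl (mem (A :\: B))); last first.
  move=> y; rewrite !inE -cB eqxx andbT subsetD1 BA /=.
  by rewrite andbC.
apply: eq_bigr => y; rewrite !inE => /andP[yB yA].
have -> : \prod_(z in A :\ y) hl z y =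
  (\prod_(z in B) hl z y) * \prod_(z in A :\: B :\ y) hl z y.
  rewrite (big_setID B) /=; congr (_ * _); apply: eq_bigl => z; rewrite !inE.
    case zB: (z \in B); rewrite ?andbF // andbT (subsetP BA) // andbT.
    by apply: contraNneq yB => <-.
  by do !case: (_ \in _); case: eqP.
have -> : hlprod B (A :\: B) = hlprod B (A :\ y :\: B) * \prod_(z in B) hl z y.
  rewrite /hlprod -big_split /=; apply: eq_bigr => b _.
  rewrite (big_setD1 y) /=; last by rewrite !inE yB.
  by rewrite mulrC; congr (_ * _); apply: eq_bigl => z; rewrite !inE andbCA.
ring.
Qed.

Lemma colpoly_gt cs A : (#|A| < head 0%N cs)%N -> colpoly cs A = 0.
Proof.
case: cs => [//|c cs] /= cA; apply: big_pred0 => B.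
apply/negP => /andP[/subset_leq_card BA /eqP cB].
by move: cA; rewrite -cB ltnNge BA.
Qed.

Fixpoint colsub cs ss : seq nat :=
  match cs, ss with
  | c :: cs', s :: ss' => (c - nat_of_bool s)%N :: colsub cs' ss'
  | _, _ => [::]
  end.

(** The one-variable skew weight. A factor [1 - t ^+ m] arises when a column keeps its length while
    the next one loses a box; [m] is then the multiplicity, in the smaller partition, of the part
    ending in this column, which explains the successor in the exponent. *)
Fixpoint branch_weight (a : R) cs ss : R :=
  match cs, ss with
  | c :: cs', s :: ss' =>
    a ^+ s * (if ~~ s && head false ss' then 1 - t ^+ (c - head 0%N cs').+1 else 1)
    * branch_weight a cs' ss'
  | _, _ => 1
  end.

Lemma head_colsub cs ss : size ss = size cs ->
  head 0%N (colsub cs ss) = (head 0%N cs - head false ss)%N.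
Proof. by case: cs ss => [|c cs] [|s ss]. Qed.

(* The part of the branching rule in which the first column is full, i.e. has
   as many boxes as there are variables besides [x a]. *)
Lemma branching_full cs a I :
    a \notin I -> (head 0%N cs <= #|I|)%N -> 0%N \notin cs ->
    (forall J : {set V}, a \notin J -> colpoly cs (a |: J) =
      sumbits (size cs)
        (fun ss => branch_weight (x a) cs ss * colpoly (colsub cs ss) J)) ->
  colpoly cs I * \prod_(i in I) hl i a +
  \sum_(j in I) (1 - t) * x a / (x a - x j) *
     ((\prod_(i in I :\ j) hl i j) * colpoly cs (a |: (I :\ j)))
  = sumbits (size cs) (fun ss => branch_weight (x a) cs ss *
      (if head false ss then 1 - t ^+ (#|I| - head 0%N cs).+1 else 1) *
      colpoly (colsub cs ss) I).
Proof.
move=> aI hI pcs IH.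
have aIj j : a \notin I :\ j by rewrite inE negb_and aI orbT.
have := colpoly_deletion cs (a |: I).
rewrite cardsU1 aI add1n subSn // (big_setU1 a aI) /= setU1K // => del.
(* Since [(1 - t) * x a / (x a - x j) = hl a j - t], the left side is the deletion sum over [a |: I]
   minus [t] times a sum that becomes, after expansion in [a], a deletion sum over [I]. *)
transitivity (qint (#|I| - head 0%N cs).+1 * colpoly cs (a |: I) -
  t * \sum_(j in I) (\prod_(i in I :\ j) hl i j) * colpoly cs (a |: (I :\ j))).
  rewrite -del [X in X + _ = _]mulrC -addrA; congr (_ + _).
  rewrite mulr_sumr -sumrB; apply: eq_bigr => j jI.
  have aj : a != j by apply: contraNneq aI => ->.
  have -> : (a |: I) :\ j = a |: (I :\ j).
    by apply/setP => z; rewrite !inE; case: (z =P a) => [->|_] /=; rewrite ?aj ?orbF ?andbT //.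
  have xaj := xsub_neq0 aj.
  by rewrite (big_setU1 a) //= /hl; field.
rewrite IH // mulr_sumbits.
under eq_bigr do rewrite IH // mulr_sumbits.
rewrite sumbits_sum mulr_sumbits -sumbitsB; apply: eq_sumbits => ss sss.
have -> : \sum_(j in I) (\prod_(i in I :\ j) hl i j) *
    (branch_weight (x a) cs ss * colpoly (colsub cs ss) (I :\ j)) =
  branch_weight (x a) cs ss *
    (qint (#|I| - head 0 (colsub cs ss))%N * colpoly (colsub cs ss) I).
  rewrite -colpoly_deletion mulr_sumr; apply: eq_bigr => j _.
  by rewrite mulrCA.
rewrite head_colsub //.
(* With N the difference of [#|I|] and the first column, the coefficient is [qint N.+1 - t * qint
   N.+1 = 1 - t ^+ N.+1] if that column loses a box, and [qint N.+1 - t * qint N = 1] otherwise. *)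
case: (boolP (head false ss)) => hss.
  have h0 : (0 < head 0%N cs)%N.
    case: cs ss {IH del hI} sss hss pcs => [|c cs] [|s ss] //= _ _.
    by rewrite inE negb_or lt0n eq_sym => /andP[].
  have -> : (#|I| - (head 0%N cs - true))%N = (#|I| - head 0%N cs).+1 by rewrite /=; lia.
  by rewrite -qintE; ring.
rewrite subn0 qintS; ring.
Qed.

(** Subsets for the first column are split by whether they contain [a]. For those that do, partial
    fractions in [x a] give a constant term, which is the case of a box removed from the first
    column, and pole terms. The pole terms join the subsets without [a], and [branching_full]
    evaluates the total as the case of an unchanged first column. *)
Lemma branching cs a A : sorted geq cs -> 0%N \notin cs -> a \notin A ->
  colpoly cs (a |: A) =
  sumbits (size cs)
    (fun ss => branch_weight (x a) cs ss * colpoly (colsub cs ss) A).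
Proof.
elim: cs A => [|c cs IH] A; first by move=> *; rewrite /= mulr1.
rewrite [0%N \in _]inE negb_or => scs /andP[c0 pcs] aA.
have {}IH (J : {set V}) : a \notin J -> _ := IH J (path_sorted scs) pcs.
have hc : (head 0%N cs <= c)%N by case: (cs) scs => //= d ? /andP[].
have {}c0 : (0 < c)%N by rewrite lt0n eq_sym.
rewrite [LHS]/= (bigID (fun B : {set V} => a \in B)) /=.
rewrite (reindex_onto (fun J => a |: J) (fun B => B :\ a)) /=; last first.
  by move=> B /andP[_ aB]; rewrite setD1K.
rewrite (eq_bigl (fun J : {set V} => (J \subset A) && (#|J| == c.-1))); last first.
  move=> J; case: (boolP (a \in J)) => aJ.
    rewrite [J \subset A](introF idP) ?andbF; last first.
      by move/subsetP/(_ _ aJ); rewrite (negPf aA).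
    apply/negbTE/negP => /andP[_ /eqP/setP/(_ a)].
    by rewrite !inE eqxx aJ.
  rewrite setU1K // eqxx andbT !inE eqxx orTb andbT cardsU1 aJ.
  rewrite -(prednK c0) add1n eqSS; congr (_ && _).
  rewrite subUset sub1set !inE eqxx /=.
  apply/idP/idP => [/subsetP H|/subset_trans]; last by apply; apply: subsetUr.
  apply/subsetP => z zJ; have := H z zJ; rewrite !inE => /orP[/eqP zE|//].
  by rewrite zE (negPf aJ) in zJ *.
have E1 : \sum_(J : {set V} | (J \subset A) && (#|J| == c.-1))
    (\prod_(b in a |: J) x b) * colpoly cs (a |: J) *
    hlprod (a |: J) ((a |: A) :\: (a |: J)) =
  \sum_(J : {set V} | (J \subset A) && (#|J| == c.-1))
    ((\prod_(b in J) x b) * x a * colpoly cs (a |: J) * hlprod J (A :\: J) +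
     \sum_(j in A :\: J)
       (\prod_(b in J) x b) * x a * colpoly cs (a |: J) * hlprod J (A :\: J) *
       ((1 - t) * x j / (x a - x j) * \prod_(k in A :\: J :\ j) hl j k)).
  apply: eq_bigr => J /andP[JA cJ].
  have aJ : a \notin J by apply: contra aA => /(subsetP JA).
  have -> : (a |: A) :\: (a |: J) = A :\: J.
    apply/setP => z; rewrite !inE; case: eqP => [->|] //=.
    by rewrite (negPf aA) andbF.
  rewrite /hlprod !(big_setU1 a aJ) /=.
  rewrite partial_fractions; last by rewrite inE negb_and aA orbT.
  by rewrite -mulr_sumr; ring.
rewrite {}E1 big_split /= -addrA [RHS]addrC.
congr (_ + _).
  have -> : c.-1 = (c - 1)%N by rewrite subn1.
  under eq_bigr => J /andP[JA _].
    rewrite IH; last by apply: contra aA => /(subsetP JA).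
    rewrite mulr_sumbits mulr_sumbitsl; over.
  rewrite sumbits_sum; apply: eq_sumbits => ss _.
  by rewrite mulr1 expr1 mulr_sumr; apply: eq_bigr => J _; ring.
rewrite [X in _ + X = _](eq_bigl (fun B : {set V} => (B \subset A) && (#|B| == c))); last first.
  move=> B /=; case: (boolP (a \in B)) => aB.
    rewrite andbF; apply/esym/negbTE/negP => /andP[/subsetP/(_ _ aB)].
    by rewrite (negPf aA).
  rewrite andbT; congr (_ && _).
  apply/idP/idP => [/subsetP H|/subset_trans]; last by apply; apply: subsetUr.
  apply/subsetP => z zB; have := H z zB; rewrite !inE => /orP[/eqP zE|//].
  by rewrite zE (negPf aB) in zB *.
(* The pole at [j] of the term of [a |: J] is charged to [I = j |: J], which again has [c] elements
   but omits [a]: the pole replaces [a] by [j]. *)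
have E2 : \sum_(J : {set V} | (J \subset A) && (#|J| == c.-1))
     \sum_(j in A :\: J)
       (\prod_(b in J) x b) * x a * colpoly cs (a |: J) * hlprod J (A :\: J) *
       ((1 - t) * x j / (x a - x j) * \prod_(k in A :\: J :\ j) hl j k) =
  \sum_(I : {set V} | (I \subset A) && (#|I| == c))
     (\prod_(b in I) x b) * hlprod I (A :\: I) *
     \sum_(j in I) (1 - t) * x a / (x a - x j) *
     ((\prod_(i in I :\ j) hl i j) * colpoly cs (a |: (I :\ j))).
  under [RHS]eq_bigr do rewrite mulr_sumr.
  rewrite (exchange_big_dep (fun j => j \in A)) /=; last first.
    by move=> J j _; rewrite inE => /andP[].
  rewrite [RHS](exchange_big_dep (fun j => j \in A)) /=; last first.
    by move=> J j /andP[/subsetP JA _]; apply: JA.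
  apply: eq_bigr => j jA.
  rewrite [RHS](reindex_onto (fun J => j |: J) (fun B => B :\ j)) /=; last first.
    by move=> B /andP[_ jB]; rewrite setD1K.
  apply: eq_big => J.
    rewrite !inE eqxx jA !andbT subUset sub1set jA /=.
    case: (boolP (j \in J)) => jJ.
      rewrite andbF; apply/esym/negbTE/negP => /andP[_ /eqP/setP/(_ j)].
      by rewrite !inE eqxx jJ.
    by rewrite setU1K // eqxx !andbT cardsU1 jJ -(prednK c0) add1n eqSS.
  rewrite inE jA andbT => /andP[/andP[JA cJ] jJ].
  rewrite setU1K // (big_setU1 j jJ) /=.
  have -> : A :\: (j |: J) = A :\: J :\ j.
    by apply/setP => z; rewrite !inE negb_or andbA.
  have H : hlprod (j |: J) (A :\: J :\ j) * \prod_(i in J) hl i j =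
     (\prod_(k in A :\: J :\ j) hl j k) * hlprod J (A :\: J).
    rewrite /hlprod (big_setU1 j jJ) /= -mulrA -big_split /=; congr (_ * _).
    apply: eq_bigr => i _; rewrite [RHS](big_setD1 j) ?inE ?jJ //=.
    by rewrite mulrC.
  have aj : a != j by apply: contraNneq aA => ->.
  have xaj := xsub_neq0 aj.
  transitivity (x j * (\prod_(b in J) x b) * ((1 - t) * x a / (x a - x j)) *
     colpoly cs (a |: J) * (hlprod (j |: J) (A :\: J :\ j) * \prod_(i in J) hl i j)).
    by rewrite H; field.
  ring.
rewrite {}E2 -big_split /=.
under eq_bigr => I /andP[IA cI].
  have aI : a \notin I by apply: contra aA => /(subsetP IA).
  have -> : (\prod_(b in I) x b) * hlprod I (A :\: I) *
      (\sum_(j in I) (1 - t) * x a / (x a - x j) *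
        ((\prod_(i in I :\ j) hl i j) * colpoly cs (a |: I :\ j))) +
    (\prod_(b in I) x b) * colpoly cs I * hlprod I ((a |: A) :\: I) =
    (\prod_(b in I) x b) * hlprod I (A :\: I) *
    (colpoly cs I * \prod_(i in I) hl i a +
     \sum_(j in I) (1 - t) * x a / (x a - x j) *
        ((\prod_(i in I :\ j) hl i j) * colpoly cs (a |: I :\ j))).
    have -> : hlprod I ((a |: A) :\: I) = hlprod I (A :\: I) * \prod_(i in I) hl i a.
      rewrite /hlprod -big_split /=; apply: eq_bigr => i _.
      rewrite (big_setD1 a) /= ?inE ?eqxx ?aI // mulrC; congr (_ * _).
      apply: eq_bigl => z; rewrite !inE; case: eqP => [->|] //=.
      by rewrite (negPf aA) andbF.
    ring.
  rewrite branching_full ?(eqP cI) // mulr_sumbits; over.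
rewrite sumbits_sum; apply: eq_sumbits => ss _.
rewrite subn0 expr0 mul1r /= mulr_sumr; apply: eq_bigr => I _; ring.
Qed.

End ColumnPolynomials.

(** * The symmetrization formula *)

Definition columns (l : seq nat) : seq nat :=
  mkseq (fun j => count (leq j.+1) l) (head 0%N l).

Lemma head_columns l : sorted geq l -> head 0%N (columns l) = count (leq 1) l.
Proof.
case: l => [|[|h] l] //= sl; apply/esym/eqP; rewrite add0n eqn0Ngt -has_count.
apply/hasP => -[k kl k0]; have /allP/(_ k kl) := order_path_min (rev_trans leq_trans) sl.
by rewrite /= leqn0 => /eqP kE; rewrite kE in k0.
Qed.

Lemma lift_max_widen n (i : 'I_n) : lift ord_max i = widen_ord (leqnSn n) i.
Proof. by apply: val_inj; apply: lift_max. Qed.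

Lemma bij_lift_perm n (i : 'I_n.+1) :
  bijective (fun p : 'I_n.+1 * 'S_n => lift_perm i p.1 p.2).
Proof.
apply: inj_card_bij; last by rewrite card_prod !card_Sn card_ord factS.
move=> [j w] [j' w'] /= E.
have jj : j = j' by rewrite -(lift_perm_id i j w) E lift_perm_id.
rewrite -jj in E *; congr pair; apply/permP => k.
by apply: (@lift_inj _ j); rewrite -!(lift_perm_lift i) E.
Qed.

Section SymmetrizationFormula.
Variables (R : fieldType) (V : finType) (t : R) (x : V -> R).
Hypothesis x_inj : injective x.

Definition permsum n (l : seq nat) (y : 'I_n -> V) : R :=
  \sum_(w : 'S_n) (\prod_(i < n) x (y (w i)) ^+ nth 0%N l i) *
    \prod_(p : 'I_n * 'I_n | (p.1 < p.2)%N) hl t x (y (w p.1)) (y (w p.2)).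

Definition qfact (m : nat) : R := \prod_(i < m) qint t i.+1.

Lemma prod_ltn_pairs m (G : 'I_m -> 'I_m -> R) :
  \prod_(p : 'I_m * 'I_m | (p.1 < p.2)%N) G p.1 p.2 =
  \prod_(j < m) \prod_(i < m) (if (i < j)%N then G i j else 1).
Proof.
rewrite exchange_big /= pair_bigA /= big_mkcond.
by apply: eq_bigr => p _.
Qed.

Lemma prod_ltn_pairsS n (F : 'I_n.+1 -> 'I_n.+1 -> R) :
  \prod_(p : 'I_n.+1 * 'I_n.+1 | (p.1 < p.2)%N) F p.1 p.2 =
  (\prod_(i < n) F (lift ord_max i) ord_max) *
  \prod_(p : 'I_n * 'I_n | (p.1 < p.2)%N) F (lift ord_max p.1) (lift ord_max p.2).
Proof.
rewrite (prod_ltn_pairs (fun i j => F (lift ord_max i) (lift ord_max j))) prod_ltn_pairs.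
rewrite big_ord_recr /= mulrC; congr (_ * _).
  rewrite big_ord_recr /= ltnn mulr1; apply: eq_bigr => i _.
  by rewrite ltn_ord lift_max_widen.
apply: eq_bigr => j _; rewrite big_ord_recr /= ltnNge ltnW //= mulr1.
by apply: eq_bigr => i _; rewrite !lift_max_widen.
Qed.

Lemma permsum_rcons n l k (y : 'I_n.+1 -> V) : size l = n ->
  permsum (rcons l k) y =
  \sum_j x (y j) ^+ k * (\prod_(z < n) hl t x (y (lift j z)) (y j)) *
    permsum l (y \o lift j).
Proof.
move=> sl; rewrite /permsum.
rewrite (reindex _ (onW_bij _ (bij_lift_perm ord_max))) /=.
transitivity (\sum_j \sum_(w : 'S_n)
  (\prod_(i < n.+1) x (y (lift_perm ord_max j w i)) ^+ nth 0%N (rcons l k) i) *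
   \prod_(p : 'I_n.+1 * 'I_n.+1 | (p.1 < p.2)%N)
    hl t x (y (lift_perm ord_max j w p.1)) (y (lift_perm ord_max j w p.2))).
  by rewrite pair_bigA.
apply: eq_bigr => j _; rewrite mulr_sumr; apply: eq_bigr => w _.
rewrite (prod_ltn_pairsS (fun u v => hl t x (y (lift_perm ord_max j w u)) (y (lift_perm ord_max j w v)))) /= lift_perm_id.
under eq_bigr do rewrite /=.
rewrite big_ord_recr /= nth_rcons sl ltnn eqxx lift_perm_id.
under eq_bigr => i _.
  rewrite nth_rcons sl ltn_ord -lift_max_widen lift_perm_lift; over.
under [X in _ * (X * _)]eq_bigr => i _ do rewrite lift_perm_lift.
under [X in _ * (_ * X)]eq_bigr => p _ do rewrite !lift_perm_lift.
rewrite (reindex_inj (@perm_inj _ w)) /= [RHS]mulrACA [RHS]mulrA.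
rewrite [X in _ = X * _ * _]mulrC -!mulrA; congr (_ * _); congr (_ * _).
by rewrite [in RHS](reindex_inj (@perm_inj _ w)).
Qed.

Lemma permsum_succ n l (y : 'I_n -> V) : size l = n ->
  permsum (map succn l) y = (\prod_(i < n) x (y i)) * permsum l y.
Proof.
move=> sl; rewrite /permsum mulr_sumr; apply: eq_bigr => w _.
rewrite mulrA; congr (_ * _); rewrite [X in _ = X * _](reindex_inj (@perm_inj _ w)) /=.
rewrite -big_split /=; apply: eq_bigr => i _.
by rewrite (nth_map 0%N) ?sl // exprS.
Qed.

(** Two moves exhaust a nonincreasing list. If its last entry is 0, delete it together with the
    variable it is assigned to; the deletion identity then yields one factor of [qfact] of the
    multiplicity of 0. If all entries are positive, lower them all by 1: the first column is full,
    so its subset sum has a single term, the product of all variables. Either move decreases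
    [sumn l + size l]. *)
Lemma permsum_colpoly n l (y : 'I_n -> V) :
    injective y -> size l = n -> sorted geq l ->
  permsum l y = (\prod_(0 <= i < (head 0%N l).+1) qfact (count_mem i l)) *
    colpoly t x (columns l) [set y i | i in setT].
Proof.
have [k] := ubnP (sumn l + size l); elim: k n l y => // k IH n l y lk y_inj.
case: n => [|n] in y y_inj *.
  move=> /size0nil -> _; rewrite /permsum /= big_nat1 /qfact big_ord0 !mulr1.
  rewrite (eq_bigr (fun _ => 1)); last first.
    move=> w _; rewrite big_ord0 big1 ?mulr1 //; by case=> -[].
  by rewrite sumr_const -cardsE (_ : [set _ | _] = setT) ?cardsT ?card_Sn ?fact0 //;
    apply/setP => w; rewrite !inE.
case/lastP: l lk => [//|l [|m]] lk.
  rewrite size_rcons => -[sl] srt.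
  have srt' : sorted geq l by move: srt; apply: subseq_sorted (subseq_rcons _ _);
    apply: rev_trans leq_trans.
  rewrite permsum_rcons //.
  have hE : head 0%N (rcons l 0%N) = head 0%N l by case: (l).
  have cE : columns (rcons l 0%N) = columns l.
    rewrite /columns hE; apply: eq_mkseq => j.
    by rewrite -cats1 count_cat /= addn0 addn0.
  have cA : #|[set y i | i in setT]| = n.+1.
    by rewrite card_imset // cardsT card_ord.
  set A := [set y i | i in setT] in cA *.
  have AE j : [set (y \o lift j) i | i in setT] = A :\ y j.
    apply/setP => v; rewrite !inE; apply/imsetP/andP => [[i _ ->]|[vj]].
      split; last exact: imset_f.
      by rewrite /= (inj_eq y_inj) eq_sym neq_lift.
    case/imsetP => i _ vE; rewrite vE (inj_eq y_inj) eq_sym in vj.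
    by have [i' iE _] := unlift_some vj; exists i'; rewrite //= -iE.
  transitivity (\sum_j (\prod_(0 <= i < (head 0%N l).+1) qfact (count_mem i l)) *
     ((\prod_(z in A :\ y j) hl t x z (y j)) *
      colpoly t x (columns l) (A :\ y j))).
    apply: eq_bigr => j _; rewrite (IH n l) //; first 1 last.
    - by move: lk; rewrite -cats1 sumn_cat size_cat /=; lia.
    - exact: inj_comp y_inj (@lift_inj _ j).
    rewrite AE expr0 mul1r mulrCA; congr (_ * (_ * _)).
    rewrite -AE big_imset /=; last by move=> ? ? _ _ /y_inj /lift_inj.
    by apply: eq_bigl => z; rewrite inE.
  rewrite -mulr_sumr.
  have -> : \sum_j (\prod_(z in A :\ y j) hl t x z (y j)) *
      colpoly t x (columns l) (A :\ y j) =
    \sum_(v in A) (\prod_(z in A :\ v) hl t x z v) * colpoly t x (columns l) (A :\ v).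
    rewrite /A big_imset /=; last by move=> ? ? _ _ /y_inj.
    by apply: eq_bigl => z; rewrite inE.
  rewrite colpoly_deletion // cA head_columns // hE cE mulrA; congr (_ * _).
  rewrite !big_nat_recl //= mulrAC; congr (_ * _); last first.
    by apply: eq_bigr => i _; rewrite -cats1 count_cat /= !addn0.
  (* The deleted 0 is no longer counted in [l] but its variable still is in [A], hence the
     successor; this is the last factor of [qfact]. *)
  have -> : (n.+1 - count (leq 1) l = (count_mem 0 l).+1)%N.
    have := count_predC (leq 1) l; rewrite sl.
    rewrite (eq_count (a1 := predC _) (a2 := pred1 0%N)); first by lia.
    by move=> i /=; rewrite -leqNgt leqn0.
  by rewrite -cats1 count_cat /= !addn0 addn1 /qfact big_ord_recr.
move=> sl srt.
set l1 := rcons l m.+1 in sl srt lk *.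
have l1pos : all (leq 1) l1.
  rewrite all_rcons /=; apply/allP => i il.
  have : sorted leq (rev l1) by rewrite rev_sorted.
  rewrite rev_rcons /= => /(order_path_min leq_trans)/allP/(_ i).
  by rewrite mem_rev => /(_ il); apply: leq_ltn_trans.
have l1E : l1 = map succn (map predn l1).
  rewrite -map_comp -[LHS]map_id; apply/eq_in_map => i /(allP l1pos) /=.
  by case: i.
set l2 := map predn l1 in l1E.
have sl2 : size l2 = n.+1 by rewrite size_map.
rewrite [in LHS]l1E permsum_succ // (IH n.+1 l2) //; first last.
- by move: srt; rewrite l1E sorted_map.
- move: lk; have -> : sumn l1 = (sumn l2 + size l2)%N.
    rewrite l1E sumnE big_map; under eq_bigr do rewrite -addn1.
    by rewrite big_split /= sum1_size -sumnE.
  by rewrite sl sl2; lia.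
have hl1 : head 0%N l1 = (head 0%N l2).+1 by rewrite l1E; case: (l2) sl2.
have cA : #|[set y i | i in setT]| = n.+1.
  by rewrite card_imset // cardsT card_ord.
have -> : columns l1 = n.+1 :: columns l2.
  rewrite /columns hl1 /mkseq /= -[in LHS](addn0 1%N); congr (_ :: _).
    by rewrite -sl; apply/eqP; rewrite -all_count.
  rewrite iotaDl -map_comp; apply: eq_map => j /=.
  by rewrite l1E count_map.
rewrite /= (big_pred1 [set y i | i in setT]); last first.
  move=> B /=; apply/andP/eqP => [[BA /eqP cB]|->].
    by apply/eqP; rewrite eqEcard BA cB cA leqnn.
  by rewrite cA.
rewrite setDv /hlprod [X in _ * (_ * _ * X)]big1; last by move=> i _; rewrite big_set0.
rewrite mulr1 mulrCA; congr (_ * _); last first.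
  congr (_ * _); rewrite big_imset /=; last by move=> ? ? _ _ /y_inj.
  by apply: eq_bigl => i; rewrite inE.
rewrite hl1 [RHS]big_nat_recl //=.
rewrite (_ : count_mem 0%N l1 = 0%N) ?{1}/qfact ?big_ord0 ?mul1r; last first.
  by rewrite l1E count_map; apply/eqP; rewrite eqn0Ngt -has_count; apply/hasP => -[].
by apply: eq_bigr => i _; rewrite l1E count_map; congr qfact; apply: eq_count.
Qed.

End SymmetrizationFormula.

(** * Linear independence *)

Lemma raddf_sumbits (U W : zmodType) (f : {additive U -> W}) n F :
  f (sumbits n F) = sumbits n (fun s => f (F s)).
Proof. by elim: n F => [//|n IH] F /=; rewrite raddfD !IH. Qed.

Lemma sumbits_pred1 (R : zmodType) n (s0 : seq bool) (G : seq bool -> R) :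
  size s0 = n -> sumbits n (fun s => if s == s0 then G s else 0) = G s0.
Proof.
elim: n s0 G => [|n IH] [|b s0] G //= [sn].
case: b.
  rewrite [X in X + _](eq_sumbits (G := fun _ => 0)) // sumbits0 add0r.
  by rewrite -(IH s0 (fun s => G (true :: s))).
rewrite [X in _ + X](eq_sumbits (G := fun _ => 0)) // sumbits0 addr0.
by rewrite -(IH s0 (fun s => G (false :: s))).
Qed.

Lemma count_id_nseq n s : size s = n -> (count id s == n) = (s == nseq n true).
Proof.
elim: n s => [|n IH] [|[] s] //= [sn]; first by rewrite add1n eqSS IH // eqseq_cons.
by rewrite add0n; apply/negbTE; rewrite neq_ltn ltnS -sn count_size.
Qed.

Lemma branch_weightE (R : fieldType) (t b : R) cs ss : size ss = size cs ->
  branch_weight t b cs ss = b ^+ count id ss * branch_weight t 1 cs ss.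
Proof.
elim: cs ss => [|c cs IH] [|s ss] //=; first by rewrite mul1r.
move=> [sn].
by rewrite IH // exprD expr1n; ring.
Qed.

Lemma branch_weight_nseq (R : fieldType) (t : R) cs :
  branch_weight t 1 cs (nseq (size cs) true) = 1.
Proof. by elim: cs => //= c cs ->; rewrite expr1 !mulr1. Qed.

Lemma colsub_nseq cs : colsub cs (nseq (size cs) true) = map predn cs.
Proof. by elim: cs => //= c cs ->; rewrite subn1. Qed.

Section ColumnPolynomialsMore.
Variables (R : fieldType) (V : finType) (t : R).
Implicit Types (x : V -> R) (A : {set V}) (cs : seq nat).

Lemma eq_colpoly x x' cs A : {in A, x =1 x'} ->
  colpoly t x cs A = colpoly t x' cs A.
Proof.
elim: cs A => [//|c cs IH] A xx /=; apply: eq_bigr => B /andP[/subsetP BA _].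
have xxB : {in B, x =1 x'} by move=> z /BA; apply: xx.
rewrite (IH B) //; congr (_ * _ * _); first exact: eq_bigr.
apply: eq_bigr => b bB; apply: eq_bigr => z; rewrite inE => /andP[_ zA].
by rewrite /hl !xx // BA.
Qed.

Lemma colpoly_filter x cs A : sorted geq cs ->
  colpoly t x [seq c <- cs | (0 < c)%N] A = colpoly t x cs A.
Proof.
elim: cs A => [//|c cs IH] A scs.
have {IH}IH B := IH B (path_sorted scs).
case: c scs => [|c] scs /=; last by apply: eq_bigr => B _; rewrite IH.
have -> : [seq c <- cs | (0 < c)%N] = [::].
  apply/eqP; rewrite -[_ == _]negbK -has_filter; apply/hasP => -[k kcs].
  have /allP/(_ k kcs) := order_path_min (rev_trans leq_trans) scs.
  by rewrite /= leqn0 => /eqP ->.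
rewrite (big_pred1 set0) => [|B] /=; last first.
  by rewrite cards_eq0; case: eqP => [->|]; rewrite ?sub0set ?andbF.
rewrite /hlprod !big_set0 -IH.
have -> : [seq c <- cs | (0 < c)%N] = [::].
  apply/eqP; rewrite -[_ == _]negbK -has_filter; apply/hasP => -[k kcs].
  have /allP/(_ k kcs) := order_path_min (rev_trans leq_trans) scs.
  by rewrite /= leqn0 => /eqP ->.
by rewrite /= !mulr1.
Qed.

(** A column longer than its predecessor asks for a subset larger than the set containing it. This
    discards the bit strings of the branching rule that do not lead to a partition. *)
Lemma colpoly_unsorted x cs A : ~~ sorted geq cs -> colpoly t x cs A = 0.
Proof.
elim: cs A => [//|c cs IH] A uns /=; apply: big1 => B /andP[_ /eqP cB].
have [hc|hc] := leqP (head 0%N cs) c.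
  rewrite IH ?mulr0 ?mul0r //; apply: contra uns.
  by case: (cs) hc => //= d ? ->.
by rewrite colpoly_gt ?cB // mulr0 mul0r.
Qed.

End ColumnPolynomialsMore.

Section LinearIndependence.
Variables (R : realFieldType) (V : finType) (t : R) (bad : seq R).
Implicit Types (x : V -> R) (A : {set V}) (cs : seq nat).

Lemma exists_injective_avoiding :
  exists2 x : V -> R, injective x & forall v, x v \notin bad.
Proof.
(* All points [N + k] exceed every element of [bad]. *)
pose N : R := 1 + \sum_(b <- bad) `|b|.
exists (fun v => N + (enum_rank v)%:R) => [u v /addrI /eqP|v].
  by rewrite eqr_nat => /eqP /val_inj /enum_rank_inj.
apply/negP => vbad.
have : N + (enum_rank v)%:R <= \sum_(b <- bad) `|b|.
  rewrite (perm_big _ (perm_to_rem vbad)) big_cons.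
  by rewrite -[leLHS]addr0 lerD ?ler_norm ?sumr_ge0.
rewrite leNgt /N -addrA addrC -addrA ltrDl => /negP[].
by rewrite ltr_wpDl // ler0n.
Qed.

Lemma poly0_of_avoiding (p : {poly R}) (s : seq R) :
  (forall b, b \notin s -> p.[b] = 0) -> p = 0.
Proof.
move=> ps; pose n := size p.
pose N : R := 1 + \sum_(b <- s) `|b|.
pose r := [seq N + i%:R | i <- iota 0 n].
apply: (roots_geq_poly_eq0 (rs := r)); last by rewrite size_map size_iota.
- apply/allP => _ /mapP[i _ ->]; apply/eqP; apply: ps; apply/negP => ibad.
  have : N + i%:R <= \sum_(b <- s) `|b|.
    rewrite (perm_big _ (perm_to_rem ibad)) big_cons.
    by rewrite -[leLHS]addr0 lerD ?ler_norm ?sumr_ge0.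
  rewrite leNgt /N -addrA addrC -addrA ltrDl => /negP[].
  by rewrite ltr_wpDl // ler0n.
- rewrite map_inj_uniq ?iota_uniq // => i j /addrI /eqP.
  by rewrite eqr_nat => /eqP.
Qed.

Definition wf_columns A cs :=
  [&& sorted geq cs, 0%N \notin cs & (head 0%N cs <= #|A|)%N].

(** Vary only the variable at [v]. By the branching rule the relation is a polynomial in its value,
    and it vanishes off a finite set. The power [K] occurs only when [K] columns all lose a box,
    that is, when a first row of length [K] is removed. *)
Lemma colpoly_top_coef x v A K (F : seq (seq nat)) (d : seq nat -> R) :
    injective x -> (forall u, x u \notin bad) -> v \in A ->
    {in F, forall cs, wf_columns A cs /\ (size cs <= K)%N} ->
    (forall x', injective x' -> (forall u, x' u \notin bad) ->
       \sum_(cs <- F) d cs * colpoly t x' cs A = 0) ->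
  \sum_(cs <- F | size cs == K) d cs * colpoly t x (map predn cs) (A :\ v) = 0.
Proof.
move=> x_inj xbad vA wf rel.
pose p : {poly R} := \sum_(cs <- F) sumbits (size cs) (fun ss =>
  (d cs * branch_weight t 1 cs ss * colpoly t x (colsub cs ss) (A :\ v))
    *: 'X^(count id ss)).
have p0 : p = 0.
  apply: (@poly0_of_avoiding _ ([seq x u | u <- enum V] ++ bad)) => b.
  rewrite mem_cat negb_or => /andP[bx bbad].
  pose x' u := if u == v then b else x u.
  have xb u : x u != b.
    by apply: contraNneq bx => <-; apply: map_f; rewrite mem_enum.
  have x'_inj : injective x'.
    move=> u w; rewrite /x'; case: eqP => [->|_]; case: eqP => [->|_] //.
    - by move=> E; move: (xb w); rewrite E eqxx.
    - by move=> E; move: (xb u); rewrite E eqxx.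
    - exact: x_inj.
  have x'bad u : x' u \notin bad by rewrite /x'; case: eqP.
  rewrite -[RHS](rel x') // /p horner_sum; apply: eq_big_seq => cs csF.
  have [/and3P[srt pos hd] _] := wf _ csF.
  rewrite -[_.[b]]/(horner_eval b _) raddf_sumbits -{2}(setD1K vA).
  rewrite (branching t x'_inj srt pos) ?setD11 // mulr_sumbits.
  apply: eq_sumbits => ss sss; rewrite /= /horner_eval hornerZ hornerXn.
  rewrite (@eq_colpoly _ _ _ x' x); last first.
    by move=> u; rewrite !inE /x' => /andP[/negPf ->].
  by rewrite /x' eqxx (branch_weightE _ b) //; ring.
have := congr1 (fun q : {poly R} => q`_K) p0; rewrite coef0 /p coef_sum => top0.
rewrite -[RHS]top0.
rewrite big_mkcond; apply: eq_big_seq => cs csF.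
have [_ csK] := wf _ csF.
rewrite -[RHS]/(coefp K _) raddf_sumbits /=.
case: eqP => [szK|/eqP szK]; last first.
  rewrite (eq_sumbits (G := fun _ => 0)) ?sumbits0 // => ss sss.
  rewrite coefZ coefXn; case: eqP; rewrite ?mulr0 // => KE; move: szK.
  by rewrite eqn_leq csK KE -sss count_size.
rewrite (eq_sumbits (G := fun ss => if ss == nseq (size cs) true then
  d cs * branch_weight t 1 cs ss * colpoly t x (colsub cs ss) (A :\ v) else 0)).
  rewrite sumbits_pred1 ?size_nseq // branch_weight_nseq colsub_nseq.
  by rewrite mulr1.
move=> ss sss; rewrite coefZ coefXn -count_id_nseq // szK eq_sym.
by case: eqP => _; rewrite ?mulr1 ?mulr0.
Qed.

(** Induction on the number of variables, then on a bound for the number of columns. Top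
    coefficients turn a relation into one with a variable less, between the partitions of maximal
    width with their first row removed; so these have coefficient 0, and the width bound drops. *)
Lemma colpoly_independent A (F : seq (seq nat)) (d : seq nat -> R) :
    uniq F -> {in F, forall cs, wf_columns A cs} ->
    (forall x, injective x -> (forall v, x v \notin bad) ->
       \sum_(cs <- F) d cs * colpoly t x cs A = 0) ->
  {in F, forall cs, d cs = 0}.
Proof.
have nil_case B (G : seq (seq nat)) e : uniq G -> {in G, forall cs, cs = [::]} ->
    (forall x, injective x -> (forall v, x v \notin bad) ->
       \sum_(cs <- G) e cs * colpoly t x cs B = 0) ->
    {in G, forall cs, e cs = 0}.
  case: G => [//|c0 [|c1 G]] uG Gnil rel.
    move=> cs csG; have /eqP csE := Gnil _ csG; move/eqP in csE.
    move: csG; rewrite csE inE => /eqP c0E.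
    have [x x_inj xbad] := exists_injective_avoiding.
    by have := rel x x_inj xbad; rewrite big_seq1 -c0E mulr1.
  by move: uG; rewrite /= (Gnil c0) ?mem_head // (Gnil c1) ?inE ?eqxx ?orbT.
have [n] := ubnP #|A|; elim: n A F d => // n IHn A F d.
have [K] : exists K, {in F, forall cs, (size cs <= K)%N}.
  exists (\max_(cs <- F) size cs) => cs csF.
  by rewrite (big_rem _ csF) /= leq_maxl.
elim: K F d => [|K IHK] F d FK An uF wf rel.
  by apply: (nil_case A) => // cs /FK; rewrite leqn0 => /nilP.
have [A0|[v vA]] := set_0Vmem A.
  apply: (nil_case A) => // -[//|c cs] /wf /and3P[_].
  by rewrite A0 cards0 inE negb_or /= leqn0 eq_sym => /andP[/negPf ->].
have top cs : cs \in F -> size cs = K.+1 -> d cs = 0.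
  pose F1 := [seq cs <- F | size cs == K.+1].
  (* Removing the first row may empty some columns, which [trim] drops. Since the row had the known
     length [K.+1], [untrim] restores it, and distinct partitions stay distinct. *)
  pose trim cs := [seq c <- map predn cs | (0 < c)%N].
  pose untrim cs := mkseq (fun i => (nth 0%N cs i).+1) K.+1.
  have trimK : {in F1, cancel trim untrim}.
    move=> {}cs; rewrite mem_filter => /andP[/eqP szK /wf /and3P[srt pos _]].
    apply: (@eq_from_nth _ 0%N); rewrite size_mkseq ?szK // => i iK.
    rewrite nth_mkseq // /trim.
    have pnth : nth 0%N cs i = (nth 0%N (map predn cs) i).+1.
      rewrite (nth_map 0%N) ?szK // prednK // lt0n.
      by apply: contraNneq pos => <-; rewrite mem_nth ?szK.
    rewrite pnth; congr _.+1.
    have : sorted geq (map predn cs).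
      rewrite sorted_map; apply: sub_sorted srt => a b /=; lia.
    elim: (map predn cs) i {iK pnth} => [//|[|c] l IHl] i pl /=.
      rewrite -/(filter _ _).
      have min0 := order_path_min (rev_trans leq_trans) pl.
      have -> : [seq c <- l | (0 < c)%N] = [::].
        apply/eqP; rewrite -[_ == _]negbK -has_filter; apply/hasP => -[k kcs].
        by have /allP/(_ k kcs) := min0; rewrite /= leqn0 => /eqP ->.
      rewrite nth_nil; case: i => //= i; have [il|il] := ltnP i (size l).
        by have /allP/(_ _ (mem_nth 0%N il)) := min0; rewrite /= leqn0 => /eqP.
      by rewrite nth_default.
    by case: i => [//|i] /=; rewrite IHl // (path_sorted pl).
  move=> csF csK; rewrite -(trimK cs) ?mem_filter ?csF ?csK ?eqxx //.
  have cA : #|A| = #|A :\ v|.+1 by rewrite (cardsD1 v) vA.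
  apply: (IHn (A :\ v) (map trim F1) (fun cs => d (untrim cs))).
  - by move: An; rewrite cA ltnS.
  - by rewrite map_inj_in_uniq ?filter_uniq //; apply: can_in_inj trimK.
  - move=> _ /mapP[l lF1 ->]; move: lF1.
    rewrite mem_filter => /andP[_ /wf /and3P[srt pos hd]].
    have srt' : sorted geq (map predn l).
      rewrite sorted_map; apply: sub_sorted srt => a b /=; lia.
    apply/and3P; split.
    + by rewrite /trim; apply: sorted_filter srt' => a b c /=; lia.
    + by rewrite mem_filter.
    + have : all (fun c => c <= #|A :\ v|)%N (trim l).
        apply/allP => k; rewrite mem_filter => /andP[_ /mapP[c cl ->]].
        suff : (c <= #|A|)%N by rewrite cA; lia.
        case: l srt cl {srt' pos} hd => //= h l srt.
        rewrite inE => /orP[/eqP -> //|cl]; apply: leq_trans.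
        by have /allP/(_ _ cl) := order_path_min (rev_trans leq_trans) srt.
      by case: (trim l) => //= ? ? /andP[].
  - move=> x x_inj xbad; rewrite big_map.
    rewrite (eq_big_seq (fun cs => d cs * colpoly t x (map predn cs) (A :\ v))).
      rewrite big_filter; apply: (colpoly_top_coef (K := K.+1)) rel => //.
      by move=> l lF; split; [apply: wf|apply: FK].
    move=> l lF1; rewrite trimK // colpoly_filter //.
    move: lF1; rewrite mem_filter => /andP[_ /wf /and3P[srt pos hd]].
    rewrite sorted_map; apply: sub_sorted srt => a b /=; lia.
  - by apply: map_f; rewrite mem_filter csF csK eqxx.
move=> cs csF; have [csK|csK] := eqVneq (size cs) K.+1; first exact: top.
apply: (IHK [seq cs <- F | size cs != K.+1]) => //.
- move=> l; rewrite mem_filter => /andP[lK /FK].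
  by rewrite leq_eqVlt (negPf lK).
- exact: filter_uniq.
- by move=> l; rewrite mem_filter => /andP[_ /wf].
- move=> x x_inj xbad; rewrite -[RHS](rel x x_inj xbad) big_filter.
  rewrite [RHS](bigID (fun cs : seq nat => size cs == K.+1)) /=.
  rewrite [X in _ = X + _]big_seq_cond [X in _ = X + _]big1 ?add0r // => l /andP[lF /eqP lK].
  by rewrite top // mul0r.
- by rewrite mem_filter csK.
Qed.

End LinearIndependence.

From mathcomp Require Import finmap.
From mathcomp Require Import all_classical all_reals all_analysis.
Import numFieldNormedType.Exports.

Local Open Scope classical_set_scope.
Local Open Scope ring_scope.

(** * Partitions and their columns *)

Definition col (lam : intpart) (j : nat) : nat := count (leq j.+1) lam.

Lemma part_sorted (lam : intpart) : sorted geq lam.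
Proof. by case: lam => l /= /andP[]. Qed.

Lemma part_pos (lam : intpart) : 0%N \notin (lam : seq nat).
Proof. by case: lam => l /= /andP[]. Qed.

Lemma transposeE (lam : intpart) : transpose lam = columns lam.
Proof. by rewrite /transpose /columns /mkseq -[1%N]addn0 iotaDl -map_comp /part nth0. Qed.

Lemma columnsE (lam : intpart) : columns lam = mkseq (col lam) (part lam 0).
Proof. by rewrite /columns /part nth0. Qed.

Lemma nth_le_part0 (lam : intpart) k : k \in (lam : seq nat) -> (k <= part lam 0)%N.
Proof.
have := part_sorted lam; rewrite /part; case: (lam : seq nat) => //= h l hl.
rewrite inE => /orP[/eqP -> //|kl].
by have /allP/(_ _ kl) := order_path_min (rev_trans leq_trans) hl.
Qed.

Lemma col_eq0 lam j : (col lam j == 0%N) = (part lam 0 <= j)%N.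
Proof.
rewrite eqn0Ngt -has_count; apply/hasPn/idP => [H|jl k /nth_le_part0 kl].
  rewrite leqNgt; apply/negP => jl; have := H (part lam 0); rewrite jl => /(_ _)/negP.
  apply=> //; rewrite /part; apply: mem_nth; rewrite lt0n; apply: contraTneq jl => l0.
  by rewrite /part nth_default // l0.
by rewrite -leqNgt (leq_trans kl).
Qed.

Lemma col0 lam : col lam 0 = len lam.
Proof.
apply/eqP; rewrite -all_count; apply/allP => k kl; rewrite lt0n.
by apply: contraTneq kl => ->; exact: part_pos.
Qed.

Lemma col_noninc lam j : (col lam j.+1 <= col lam j)%N.
Proof. by apply: sub_count => k; apply: ltnW. Qed.

Lemma mult_col lam j : mult lam j.+1 = (col lam j - col lam j.+1)%N.
Proof.
have E : (col lam j = mult lam j.+1 + col lam j.+1)%N.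
  rewrite /col /mult; elim: (lam : seq nat) => //= k l ->.
  have -> : (j < k = (k == j.+1) + (j.+1 < k) :> nat)%N by lia.
  by rewrite addnACA.
by rewrite E addnK.
Qed.

Lemma col_inj lam mu : col lam =1 col mu -> lam = mu.
Proof.
move=> E; apply: val_inj => /=.
apply: (sorted_eq (leT := geq)).
- by move=> a b c /=; lia.
- by move=> a b /=; lia.
- exact: part_sorted.
- exact: part_sorted.
- rewrite /perm_eq; apply/allP => -[|k] _ /=.
    by rewrite !(count_memPn _) ?part_pos.
  by rewrite -[X in X == _]/(mult lam _) -[X in _ == X]/(mult mu _) !mult_col !E.
Qed.

Fact add_col_subproof c (lam : intpart) :
  let l := map succn lam ++ nseq (c - len lam) 1%N in
  sorted geq l && (0%N \notin l).
Proof.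
apply/andP; split.
  rewrite (sorted_pairwise (leT := geq)); last by move=> a b d /=; lia.
  rewrite pairwise_cat -!(sorted_pairwise (leT := geq));
    try by move=> a b d /=; lia.
  apply/and3P; split.
  - apply/allrelP => _ b /mapP[a _ ->] /nseqP[-> _] //.
  - by rewrite sorted_map; apply: sub_sorted (part_sorted lam) => a b.
  - by elim: (c - len lam)%N => //= -[].
rewrite mem_cat negb_or; apply/andP; split; first by apply/mapP => -[].
by apply/nseqP => -[].
Qed.

(* Inserts a new first column, of length [maxn c (len lam)]. *)
Definition add_col c (lam : intpart) : intpart := IntPart (add_col_subproof c lam).

Lemma col_add_col0 c lam : (len lam <= c)%N -> col (add_col c lam) 0 = c.
Proof. by move=> lc; rewrite col0 /len /= size_cat size_map size_nseq subnKC. Qed.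

Lemma col_add_colS c lam j : col (add_col c lam) j.+1 = col lam j.
Proof.
rewrite /col /= count_cat count_map.
by rewrite (_ : count _ (nseq _ _) = 0%N) ?addn0 // count_nseq.
Qed.

Lemma part_add_col c lam : part (add_col c lam) 0 =
  if (c == 0%N) && (part lam 0 == 0%N) then 0%N else (part lam 0).+1.
Proof.
rewrite /part /= /len; have := part_pos lam.
case: (lam : seq nat) => [|h l] /=; first by rewrite subn0 andbT; case: c.
by rewrite inE negb_or eq_sym => /andP[/negPf -> _]; rewrite andbF.
Qed.

Definition part_of_columns (cs : seq nat) : intpart := foldr add_col empty_part cs.

Lemma col_part_of_columns cs j : sorted geq cs -> col (part_of_columns cs) j = nth 0%N cs j.
Proof.
elim: cs j => [|c cs IH] j scs; first by rewrite nth_nil.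
have scs' := path_sorted scs.
case: j => [|j]; last by rewrite /= col_add_colS IH.
rewrite /= col_add_col0 // -col0 IH //.
by case: (cs) scs => //= d ? /andP[].
Qed.

Lemma columns_wf (lam : intpart) : sorted geq (columns lam) && (0%N \notin columns lam).
Proof.
rewrite columnsE; apply/andP; split.
  apply/(sortedP 0%N) => i; rewrite size_mkseq => ilt.
  by rewrite !nth_mkseq ?(ltnW ilt) //= col_noninc.
apply/mapP => -[j]; rewrite mem_iota /= add0n => jlt /esym/eqP.
by rewrite col_eq0 leqNgt jlt.
Qed.

Lemma nth_columns (lam : intpart) j : nth 0%N (columns lam) j = col lam j.
Proof.
rewrite columnsE; have [jl|jl] := ltnP j (part lam 0); first by rewrite nth_mkseq.
by rewrite nth_default ?size_mkseq //; apply/esym/eqP; rewrite col_eq0.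
Qed.

Lemma size_columns (lam : intpart) : size (columns lam) = part lam 0.
Proof. by rewrite columnsE size_mkseq. Qed.

Lemma columnsK : cancel (fun lam : intpart => columns lam) part_of_columns.
Proof.
move=> lam; apply: col_inj => j; rewrite col_part_of_columns ?nth_columns //.
by case/andP: (columns_wf lam).
Qed.

Lemma columns_part_of_columns cs : sorted geq cs ->
  columns (part_of_columns cs) = [seq c <- cs | (0 < c)%N].
Proof.
move=> scs.
have sf : sorted geq [seq c <- cs | (0 < c)%N].
  by apply: sorted_filter scs => a b c /=; lia.
have nf j : nth 0%N [seq c <- cs | (0 < c)%N] j = nth 0%N cs j.
  elim: cs j scs {sf} => [//|c cs IH] j scs /=.
  case: c scs => [|c] scs; last by case: j => //= j; rewrite IH // (path_sorted scs).
  have min0 := order_path_min (rev_trans leq_trans) scs.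
  have z i : nth 0%N cs i = 0%N.
    have [il|il] := ltnP i (size cs); last by rewrite nth_default.
    by have /allP/(_ _ (mem_nth 0%N il)) := min0; rewrite /= leqn0 => /eqP.
  by rewrite /= IH ?(path_sorted scs) // z; case: j => //= j; rewrite z.
have E : part_of_columns cs = part_of_columns [seq c <- cs | (0 < c)%N].
  by apply: col_inj => j; rewrite !col_part_of_columns // nf.
have sz : part (part_of_columns cs) 0 = size [seq c <- cs | (0 < c)%N].
  apply/eqP; rewrite eqn_leq -col_eq0 E col_part_of_columns // nth_default //=.
  set l := [seq c <- cs | (0 < c)%N] in sf nf E *.
  rewrite leqNgt; apply/negP => lt.
  have /eqP : (nth 0%N l (part (part_of_columns l) 0)) = 0%N.
    by rewrite -col_part_of_columns //; apply/eqP; rewrite col_eq0.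
  have : 0%N \notin l by rewrite mem_filter.
  by apply: contraNnot => /eqP <-; rewrite mem_nth.
apply: (@eq_from_nth _ 0%N); rewrite size_columns // => j _.
by rewrite nth_columns col_part_of_columns // nf.
Qed.

(** * One-variable skew functions *)

(* The factor of the skew function carried by one column: [d] and [d1] are the
   lengths of that column and of the next one in the larger partition, [e] and
   [e1] those in the smaller one. *)
Definition strip_weight (R : pzRingType) (t a : R) (d d1 e e1 : nat) : R :=
  if (e <= d <= e.+1)%N then
    a ^+ (d - e) * (if (d == e) && (d1 == e1.+1) then 1 - t ^+ (e - e1) else 1)
  else 0.

(** At most one bit string leads from [cs] to [es]. This turns the coefficient of a given smaller
    partition into a product of local factors, one per column. *)
Lemma sumbits_branch_weight (R : fieldType) (t a : R) cs es :
    sorted geq cs -> 0%N \notin cs -> size es = size cs ->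
  sumbits (size cs)
    (fun ss => if colsub cs ss == es then branch_weight t a cs ss else 0) =
  \prod_(j < size cs) strip_weight t a (nth 0%N cs j) (nth 0%N cs j.+1)
                                       (nth 0%N es j) (nth 0%N es j.+1).
Proof.
elim: cs es => [|c cs IH] [|e es] //=; first by rewrite big_ord0.
move=> scs; rewrite inE negb_or => /andP[c0 pcs] [se].
have hc : (head 0%N cs <= c)%N by case: (cs) scs => //= d ? /andP[].
have {}IH := IH es (path_sorted scs) pcs se.
rewrite big_ord_recl /= -IH !mulr_sumbits.
rewrite [X in X + _ = _](eq_sumbits (G := fun ss => strip_weight t a c (nth 0%N cs 0) e (nth 0%N es 0) *
   (if c == e then if colsub cs ss == es then branch_weight t a cs ss else 0 else 0)));
  last first.
  move=> ss sss; rewrite subn0 eqseq_cons.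
  have [<-{e}|ce] := eqVneq c e; rewrite /= ?mulr0 //.
  case: eqP => [ees|]; rewrite ?mulr0 // expr0 mul1r; congr (_ * _).
  rewrite /strip_weight leqnn leqnSn /= subnn expr0 mul1r eqxx /= -ees.
  rewrite nth0 nth0 head_colsub //.
  case: (cs) (ss) sss hc pcs => [|c' cs'] [|[] ss'] //= _ hc.
    rewrite inE negb_or => /andP[c'0 _].
    rewrite subn1 prednK ?lt0n 1?eq_sym // eqxx.
    by congr (1 - _ ^+ _); move: c'0; lia.
  by rewrite subn0 eqn_leq ltnn andbF.
rewrite [X in _ + X = _](eq_sumbits (G := fun ss =>
   strip_weight t a c (nth 0%N cs 0) e (nth 0%N es 0) *
   (if c == e then 0 else if colsub cs ss == es then branch_weight t a cs ss else 0)));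
  last first.
  move=> ss sss; rewrite eqseq_cons /= subn1 /strip_weight expr1 mulr1.
  have [ce|ce] := eqVneq c e.
    rewrite mulr0 -ce; case: eqP => //= ee; exfalso; move: c0 ee; lia.
  have [cE|cE] /= := eqVneq c.-1 e.
    have -> : c = e.+1 by move: c0 cE; lia.
    rewrite leqnn leqnSn /= subSnn expr1 mulr1.
    by case: ifP => _; rewrite ?mulr0.
  by rewrite ifF ?mul0r //; move: c0 ce cE; lia.
rewrite -sumbitsD; apply: eq_sumbits => ss _.
by case: eqP => _; rewrite !mulr0 ?addr0 ?add0r.
Qed.

Lemma size_colsub cs ss : size ss = size cs -> size (colsub cs ss) = size cs.
Proof. by elim: cs ss => [|c cs IH] [|s ss] //= [] /IH ->. Qed.

(** * Comparison with the symmetrized polynomials and their skew functions *)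

Section HallLittlewoodP.
Variables (R : realType) (t : R).
Hypothesis ht : 0 <= t < 1.

Lemma vfacE m : vfac t m = qfact t m.
Proof.
have t1 : 1 - t != 0 by rewrite subr_eq0 eq_sym lt_eqF //; case/andP: ht.
rewrite /vfac /qfact big_add1 big_mkord; apply: eq_bigr => i _ /=.
by rewrite -qintE mulrC mulKf.
Qed.

Lemma vfac_neq0 m : vfac t m != 0.
Proof.
rewrite vfacE /qfact; apply/prodf_neq0 => i _; rewrite gt_eqF //.
case/andP: ht => t0 _.
by rewrite qintS ltr_pwDl // mulr_ge0 // sumr_ge0 // => j _; rewrite exprn_ge0.
Qed.

(** Pad the parts with zeros up to the number of variables: [vpart] is then exactly the product of
    [qfact] of multiplicities. With too few variables both sides are 0. The embedding [y] allows two
    sets of variables, one with [a] and one without, to live in the same type. *)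
Lemma HL_P_colpoly (V : finType) (x : V -> R) (lam : intpart) (X : seq R)
    (y : 'I_(size X) -> V) :
    injective x -> injective y -> (forall i : 'I_(size X), X`_i = x (y i)) ->
  HL_P t lam X = colpoly t x (columns lam) [set y i | i in [set: 'I_(size X)]%SET]%SET.
Proof.
move=> x_inj y_inj XE; rewrite /HL_P; set A := [set y i | i in [set: 'I_(size X)]%SET]%SET.
have cA : #|A| = size X by rewrite card_imset // cardsT card_ord.
case: leqP => [lX|Xl]; last first.
  rewrite colpoly_gt // cA head_columns ?part_sorted //.
  by rewrite -[count _ _]/(col lam 0) col0.
pose l := (lam : seq nat) ++ nseq (size X - len lam) 0%N.
have sl : size l = size X by rewrite size_cat size_nseq subnKC.
have srt : sorted geq l.
  rewrite (sorted_pairwise (leT := geq)); last by move=> a b d /=; lia.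
  rewrite pairwise_cat -!(sorted_pairwise (leT := geq));
    try by move=> a b d /=; lia.
  apply/and3P; split; last 1 first.
  - by elim: (size X - len lam)%N => //= -[].
  - by apply/allrelP => a b _ /nseqP[->].
  - exact: part_sorted.
have hl : head 0%N l = part lam 0.
  by rewrite /l /part -nth0; case: (lam : seq nat) => //=; case: (_ - _)%N.
have -> : columns lam = columns l.
  rewrite {2}/columns hl columnsE; apply: eq_mkseq => j.
  by rewrite /col /l count_cat count_nseq mul0n addn0.
have := permsum_colpoly t x_inj y_inj sl srt.
rewrite hl /permsum => H.
apply: (canLR (mulfK _)).
  rewrite mulf_neq0 ?vfac_neq0 //; rewrite prodf_seq_neq0; apply/allP => i _; exact: vfac_neq0.
rewrite mulrC; move: H.
have -> : \prod_(0 <= i < (part lam 0).+1) qfact t (count_mem i l) = vpart t (size X) lam.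
  rewrite big_nat_recl // /vpart; congr (_ * _).
    rewrite vfacE /l count_cat count_nseq /= mul1n.
    by rewrite (count_memPn (part_pos lam)).
  rewrite big_add1 /=; apply: eq_bigr => i _; rewrite vfacE /l count_cat count_nseq.
  by rewrite /mult /= addn0.
move=> <-; apply: eq_bigr => w _; congr (_ * _).
  apply: eq_bigr => i _; rewrite XE /part /l nth_cat; congr (_ ^+ _).
  by case: ltnP => // il; rewrite nth_default // nth_nseq if_same.
by apply: eq_bigr => p _; rewrite !XE.
Qed.

(** Take as many variables as the longest partition in the two finite supports, and forbid the value
    [a] so that both expansions may be evaluated. Their difference is a linear relation between
    independent polynomials. *)
Lemma skew_expansion_unique (lam : intpart) (a : R) c1 c2 :
  skew_expansion t lam a c1 -> skew_expansion t lam a c2 -> c1 = c2.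
Proof.
move=> [fin1 E1] [fin2 E2]; apply/funext => mu; apply/eqP; rewrite -subr_eq0.
set d := fun mu => c1 mu - c2 mu.
have [L uL LE] : exists2 L : seq intpart, uniq L &
    forall nu, nu \notin L -> c1 nu = 0 /\ c2 nu = 0.
  have fin12 : finite_set ([set nu | c1 nu != 0] `|` [set nu | c2 nu != 0])%classic.
    by rewrite finite_setU.
  exists (enum_fset (fset_set ([set nu | c1 nu != 0] `|` [set nu | c2 nu != 0])%classic)).
    exact: fset_uniq.
  move=> nu; rewrite in_fset_set // notin_setE => /not_orP[].
  by move=> /negP /negbNE /eqP -> /negP /negbNE /eqP ->.
have [muL|/LE[-> ->]] := boolP (mu \in L); last by rewrite subrr.
pose n := \max_(nu <- L) len nu.
pose F := [seq columns (nu : intpart) | nu <- L].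
rewrite -[_ - _]/(d mu) -[mu]columnsK.
rewrite (@colpoly_independent R 'I_n t [:: a] [set: 'I_n] F
  (fun cs => d (part_of_columns cs))) //.
- by rewrite map_inj_uniq //; apply: can_inj columnsK.
- move=> _ /mapP[nu nuL ->]; have /andP[srt pos] := columns_wf nu; rewrite /wf_columns srt pos.
  rewrite /= cardsT card_ord -nth0 nth_columns col0.
  by rewrite /n (big_rem _ nuL) /= leq_maxl.
- move=> x x_inj xa; pose X := [seq x i | i <- enum 'I_n].
  have sX : size X = n by rewrite size_map size_enum_ord.
  have uX : uniq (rcons X a).
    rewrite rcons_uniq map_inj_uniq ?enum_uniq // andbT; apply/mapP => -[i _ aE].
    by have := xa i; rewrite -aE inE eqxx.
  have PE nu : HL_P t nu X = colpoly t x (columns nu) [set: 'I_n].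
    have XE (i : 'I_(size X)) : X`_i = x (cast_ord sX i).
      rewrite (nth_map (cast_ord sX i)) ?size_enum_ord -?sX //.
      by congr x; apply: val_inj; rewrite /= nth_enum_ord // -sX.
    rewrite (HL_P_colpoly nu x_inj (@cast_ord_inj _ _ sX) XE).
    congr colpoly; apply/setP => i; rewrite inE; apply/imsetP.
    by exists (cast_ord (esym sX) i); rewrite // cast_ordKV.
  have := E1 X uX; rewrite (E2 X uX).
  have fsE c : (forall nu, nu \notin L -> c nu = 0) ->
      \sum_(nu \in [set: intpart]) c nu * HL_P t nu X = \sum_(nu <- L) c nu * HL_P t nu X.
    move=> cL; rewrite (fsbigE L) //.
      by apply: eq_bigl => nu; rewrite in_setT.
    by move=> nu _ /cL ->; rewrite mul0r.
  rewrite !fsE; try by move=> nu /LE[].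
  move/esym/eqP; rewrite -subr_eq0 -sumrB => /eqP H; rewrite -[RHS]H big_map.
  by apply: eq_bigr => nu _; rewrite columnsK PE -mulrBl.
- exact: map_f.
Qed.

Definition skew_coef (lam : intpart) (a : R) (mu : intpart) : R :=
  \prod_(j < maxn (part lam 0) (part mu 0))
    strip_weight t a (col lam j) (col lam j.+1) (col mu j) (col mu j.+1).

Lemma skew_coefE M lam a mu :
    (part lam 0 <= M)%N -> (part mu 0 <= M)%N ->
  skew_coef lam a mu = \prod_(j < M)
    strip_weight t a (col lam j) (col lam j.+1) (col mu j) (col mu j.+1).
Proof.
move=> lM mM; rewrite /skew_coef; set m := maxn _ _.
have mM' : (m <= M)%N by rewrite geq_max lM.
rewrite -!(big_mkord predT (fun j => strip_weight t a (col lam j) (col lam j.+1)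
   (col mu j) (col mu j.+1))).
rewrite [RHS](big_cat_nat (n := m)) //= [X in _ = _ * X]big_nat_cond [X in _ = _ * X]big1 ?mulr1 //.
move=> j /andP[/andP[mj _] _].
have z nu : (part nu 0 <= m)%N -> col nu j = 0%N /\ col nu j.+1 = 0%N.
  move=> h; split; apply/eqP; rewrite col_eq0 (leq_trans h) //.
  exact: leq_trans mj (leqnSn _).
have [-> ->] := z lam (leq_maxl _ _); have [-> ->] := z mu (leq_maxr _ _).
by rewrite /strip_weight /= expr0 mulr1.
Qed.

Lemma skew_coef_gt lam a mu : (part lam 0 < part mu 0)%N -> skew_coef lam a mu = 0.
Proof.
move=> lm; apply/eqP; rewrite prodf_seq_eq0; apply/hasP.
have jl : ((part mu 0).-1 < maxn (part lam 0) (part mu 0))%N by lia.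
exists (Ordinal jl); rewrite ?mem_index_enum //=.
have /eqP -> : col lam (part mu 0).-1 == 0%N by rewrite col_eq0; lia.
have : col mu (part mu 0).-1 != 0%N by rewrite col_eq0; lia.
by rewrite /strip_weight; case: (col mu _).
Qed.

(** The branching rule in the last variable, with its bit strings grouped by the partition they lead
    to; the others contribute 0. Only finitely many partitions are reached, which gives the finite
    support. *)
Lemma skew_expansion_coef (lam : intpart) (a : R) :
  skew_expansion t lam a (skew_coef lam a).
Proof.
have /andP[srt pos] := columns_wf lam; pose k := part lam 0.
have szc : size (columns lam) = k by exact: size_columns.
have coefE mu : skew_coef lam a mu = sumbits k (fun ss =>
    if sorted geq (colsub (columns lam) ss) &&
       (part_of_columns (colsub (columns lam) ss) == mu)
    then branch_weight t a (columns lam) ss else 0).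
  have [muk|kmu] := leqP (part mu 0) k; last first.
    rewrite skew_coef_gt // (eq_sumbits (G := fun _ => 0)) ?sumbits0 // => ss sss.
    case: ifP => // /andP[ssrt /eqP muE]; exfalso.
    have : col mu k != 0%N by rewrite col_eq0 -ltnNge.
    rewrite -muE col_part_of_columns // nth_default //.
    by rewrite size_colsub szc.
  rewrite (skew_coefE (M := k)) // -szc.
  rewrite (eq_bigr (fun j : 'I_(size (columns lam)) =>
    strip_weight t a (nth 0%N (columns lam) j) (nth 0%N (columns lam) j.+1)
      (nth 0%N (mkseq (col mu) k) j) (nth 0%N (mkseq (col mu) k) j.+1))); last first.
    move=> j _; rewrite !nth_columns.
    have nE i : nth 0%N (mkseq (col mu) k) i = col mu i.
      have [ik|ki] := ltnP i k; first by rewrite nth_mkseq.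
      rewrite nth_default ?size_mkseq //; apply/esym/eqP.
      by rewrite col_eq0 (leq_trans muk).
    by rewrite !nE.
  rewrite -sumbits_branch_weight ?size_mkseq //.
  apply: eq_sumbits => ss sss.
  have szs : size (colsub (columns lam) ss) = k by rewrite size_colsub szc.
  congr (if _ then _ else _); apply/idP/idP.
    move=> /eqP ->; have ms : sorted geq (mkseq (col mu) k).
      apply/(sortedP 0%N) => i; rewrite size_mkseq => ilt.
      by rewrite !nth_mkseq ?(ltnW ilt) //= col_noninc.
    rewrite ms /=; apply/eqP/col_inj => j; rewrite col_part_of_columns //.
    have [ik|ki] := ltnP j k; first by rewrite nth_mkseq.
    rewrite nth_default ?size_mkseq //; apply/esym/eqP.
    by rewrite col_eq0 (leq_trans muk).
  move=> /andP[ssrt /eqP muE]; apply/eqP/(@eq_from_nth _ 0%N).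
    by rewrite size_mkseq.
  by rewrite szs => i ik; rewrite nth_mkseq // -muE col_part_of_columns.
have bitsP ss : size ss = k -> ss \in [seq val s | s : k.-tuple bool].
  by move=> /eqP sss; apply/fintype.imageP; exists (Tuple sss).
pose L := undup [seq part_of_columns (colsub (columns lam) ss) |
                  ss <- [seq val s | s : k.-tuple bool]].
have L0 mu : mu \notin L -> skew_coef lam a mu = 0.
  move=> muL; rewrite coefE (eq_sumbits (G := fun _ => 0)) ?sumbits0 // => ss sss.
  case: ifP => // /andP[_ /eqP muE]; exfalso; move: muL.
  rewrite mem_undup => /mapP; apply.
  by exists ss; [exact: bitsP|rewrite muE].
split.
  apply: sub_finite_set (finite_seq L) => mu /= nz.
  by apply: contraNT nz => /L0 ->; rewrite eqxx.
move=> x ux; have uL : uniq L by exact: undup_uniq.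
rewrite (fsbigE L) //; last by move=> mu _ /L0 ->; rewrite mul0r.
set X := rcons x a; have sX : size X = (size x).+1 by rewrite size_rcons.
pose z (i : 'I_(size X)) : R := X`_i.
have z_inj : injective z.
  by move=> i j /eqP; rewrite /z nth_uniq // => /eqP /val_inj.
have sxX : (size x <= size X)%N by rewrite sX.
rewrite (@HL_P_colpoly _ z lam X id z_inj (@inj_id _) (fun=> erefl)).
have PE mu : HL_P t mu x = colpoly t z (columns mu)
    [set widen_ord sxX i | i in [set: 'I_(size x)]%SET]%SET.
  apply: HL_P_colpoly => //; first by move=> i j /(congr1 val) /= E; apply: val_inj.
  by move=> i; rewrite /z nth_rcons /= ltn_ord.
have lX : (size x < size X)%N by rewrite sX.
set A := imset _ _ in PE.
have -> : [set id i | i in [set: 'I_(size X)]%SET]%SET = Ordinal lX |: A.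
  apply/setP => i; rewrite imset_id !inE; apply/esym/orP.
  have [ix|xi] := ltnP i (size x).
    by right; apply/imsetP; exists (Ordinal ix) => //; apply: val_inj.
  left; apply/eqP/val_inj => /=; apply/eqP.
  by rewrite eqn_leq xi andbT -ltnS -sX ltn_ord.
have XA : Ordinal lX \notin A.
  by apply/imsetP => -[i _ /(congr1 val) /= E]; have := ltn_ord i; rewrite -E ltnn.
rewrite (branching t z_inj srt pos XA) szc.
rewrite (_ : z (Ordinal lX) = a); last by rewrite /z nth_rcons ltnn eqxx.
rewrite (eq_bigr (fun mu => sumbits k (fun ss =>
    (if sorted geq (colsub (columns lam) ss) &&
       (part_of_columns (colsub (columns lam) ss) == mu)
    then branch_weight t a (columns lam) ss else 0) * HL_P t mu x))); last first.
  by move=> mu _; rewrite coefE mulr_sumbitsl.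
rewrite sumbits_sum; apply: eq_sumbits => ss sss.
rewrite (eq_bigl predT) => [|mu]; last by rewrite in_setT.
have [ssrt|suns] := boolP (sorted geq (colsub (columns lam) ss)); last first.
  by rewrite big1 => [|mu _]; rewrite ?mul0r // colpoly_unsorted ?mulr0.
have muL : part_of_columns (colsub (columns lam) ss) \in L.
  by rewrite mem_undup; apply/mapP; exists ss; [exact: bitsP|].
rewrite (big_rem _ muL) /= eqxx big_seq big1 => [|mu]; last first.
  rewrite mem_rem_uniq // !inE => /andP[muE _].
  by rewrite eq_sym (negPf muE) mul0r.
by rewrite addr0 PE columns_part_of_columns // colpoly_filter.
Qed.

Lemma HL_skewPE lam mu a : HL_skewP t lam mu a = skew_coef lam a mu.
Proof.
rewrite /HL_skewP (@xget_unique _ _ _ (skew_coef lam a)) //.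
  exact: skew_expansion_coef.
by move=> c /skew_expansion_unique; apply; apply: skew_expansion_coef.
Qed.

End HallLittlewoodP.

(** * Yang-Baxter equation and the fixed vector *)

Lemma exchange_sumbits (R : zmodType) n m (F : seq bool -> seq bool -> R) :
  sumbits n (fun s => sumbits m (F s)) = sumbits m (fun s' => sumbits n (fun s => F s s')).
Proof. by elim: n F => [//|n IH] F /=; rewrite !IH -sumbitsD. Qed.

Lemma sumbitsS (R : zmodType) n (F : seq bool -> R) : sumbits n.+1 F =
  sumbits n (fun s => F (false :: s)) + sumbits n (fun s => F (true :: s)).
Proof. by []. Qed.

Section BosonColumn.
Variables (R : realType) (t : R).
Implicit Types (a b : R) (al : seq R) (s : seq bool).

(* The t-boson vertex: a column of the partition diagram holds [m] particles
   (the current multiplicity), and the horizontal edge changes from [x] to [y]. *)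
Definition boson_weight a (m : nat) (x y : bool) : R :=
  if x && ~~ y then 1 - t ^+ m else if y then a else 1.

(** For nonzero [b] this is [b * boson_weight b^-1 m w w']: the vertex where the new six-vertex row
    crosses the boson column, with inverted spectral parameter. *)
Definition dual_boson_weight b (m : nat) (w w' : bool) : R :=
  if w && ~~ w' then b * (1 - t ^+ m) else if w' then 1 else b.

(** The contribution of one multiplicity [m] to [b_el], together with the condition that all
    multiplicities are even. *)
Definition top_weight (m : nat) : R :=
  if odd m then 0 else \prod_(1 <= k < (m./2).+1) (1 - t ^+ (k.*2.-1)).

(** The truncated subtraction does no harm: a particle leaving an empty column has weight
    [1 - t ^+ 0 = 0]. *)
Fixpoint column_weight al (m : nat) (s s' : seq bool) : R :=
  match al, s, s' with
  | a :: al', x :: u, y :: u' =>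
    boson_weight a m x y * column_weight al' (m + y - x)%N u u'
  | [::], [::], [::] => top_weight m
  | _, _, _ => 0
  end.

(* The new row carries the parameter [b], enters with west state [w] and ends
   at a corner. *)
Fixpoint row_weight b al (w : bool) (s s' : seq bool) : R :=
  match al, s, s' with
  | a :: al', x :: u, h :: u' =>
    bulk_weight t (a * b) w x true h * row_weight b al' true u u' +
    bulk_weight t (a * b) w x false h * row_weight b al' false u u'
  | [::], [::], [:: h] => corner_weight w h
  | _, _, _ => 0
  end.

(** The corner flips the state, so this is the boundary counterpart of the Yang-Baxter equation. It
    amounts to [top_weight m.+2 = top_weight m * (1 - t ^+ m.+1)], the recursion behind the odd
    exponents in [b_el]. *)
Lemma top_weight_reflection b m (h g : bool) :
  boson_weight b m h g * top_weight (m + g - h) =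
  dual_boson_weight b m (~~ h) (~~ g) * top_weight (m + ~~ g - ~~ h).
Proof.
have topSS k : top_weight k.+2 = top_weight k * (1 - t ^+ k.+1).
  rewrite /top_weight /= negbK; case: ifP => odk; first by rewrite mul0r.
  rewrite big_nat_recr //=; congr (_ * (1 - _ ^+ _)).
  by have := odd_double_half k; rewrite odk; lia.
case: h; case: g; rewrite /boson_weight /dual_boson_weight //=;
  rewrite ?addn0 ?addn1 ?subn0 ?subn1 ?addnK //=.
- case: m => [|m] /=; last by rewrite topSS; ring.
  by rewrite expr0 subrr mul0r mul1r /top_weight.
- case: m => [|m]; first by rewrite expr0 subrr /top_weight /= !(mulr0, mul0r).
  by rewrite topSS /=; ring.
Qed.

(** By conservation at the bulk vertex, both sides end with the same particle number for given outer
    states. The arbitrary [G] of that number stands for the rest of the column, so that the equation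
    can be applied inside a larger sum. *)
Lemma yang_baxter a b m (w x e' g : bool) (G : nat -> R) : 1 - t * (a * b) != 0 ->
  \sum_(e : bool) \sum_(h : bool) bulk_weight t (a * b) w x e h *
     boson_weight a m h g * dual_boson_weight b (m + g - h) e e' *
     G (m + g - h + e' - e)%N =
  \sum_(w1 : bool) \sum_(y : bool) dual_boson_weight b m w w1 *
     boson_weight a (m + w1 - w) x y * bulk_weight t (a * b) w1 y e' g *
     G (m + w1 - w + y - x)%N.
Proof.
move=> u0; rewrite !big_bool /=.
case: w; case: x; case: e'; case: g; rewrite /boson_weight /dual_boson_weight /=;
  case: m => [|m]; rewrite ?(addn0, addn1, subn0, subn1) /=
    ?(addn0, addn1, subn0, subn1) /= ?(expr0, exprS);
  by field.
Qed.

(** The crossing of row and column is moved along the row, past one vertex at a time by the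
    Yang-Baxter equation, until the reflection identity absorbs it at the corner; there the column
    acquires its vertex of parameter [b]. *)
Lemma row_column_exchange b al m w s s'' :
    (forall a, a \in al -> 1 - t * (a * b) != 0) ->
    size s = size al -> size s'' = (size al).+1 ->
  sumbits (size al).+1
    (fun s' => row_weight b al w s s' * column_weight (rcons al b) m s' s'') =
  \sum_(w1 : bool) dual_boson_weight b m w w1 * sumbits (size al)
    (fun s' => column_weight al (m + w1 - w)%N s s' * row_weight b al w1 s' s'').
Proof.
elim: al m w s s'' => [|a al IH] m w [|x s] [|g s''] // ub.
  case: s'' => // _ _.
  have := top_weight_reflection b m (~~ w) g; rewrite negbK.
  rewrite big_bool /= /corner_weight; case: w; case: g => /= E;
    by move: E; rewrite /boson_weight /dual_boson_weight /=
      ?(mul1r, mul0r, mulr0, mulr1, add0r, addr0).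
move=> [sz] [sz''].
have ua : 1 - t * (a * b) != 0 by apply: ub; rewrite mem_head.
have {}IH m' w' := IH m' w' s s'' (fun c cal => ub c (mem_behead (cal : c \in behead (a :: al)))) sz sz''.
pose G e' k := sumbits (size al)
  (fun s' => column_weight al k s s' * row_weight b al e' s' s'').
transitivity (\sum_(e : bool) \sum_(h : bool) bulk_weight t (a * b) w x e h *
  boson_weight a m h g * (\sum_(e' : bool) dual_boson_weight b (m + g - h) e e' *
     G e' (m + g - h + e' - e)%N)).
  under [RHS]eq_bigr => e _ do under eq_bigr => h _ do rewrite /G -IH.
  rewrite [RHS]exchange_big big_bool !big_bool [size (_ :: _)]/= sumbitsS addrC.
  rewrite !mulr_sumbits -[RHS]/((_ + _) + (_ + _)) -!sumbitsD.
  by apply: eq_sumbits => s' _ /=; ring.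
transitivity (\sum_(e' : bool) \sum_(w1 : bool) \sum_(y : bool) dual_boson_weight b m w w1 *
     boson_weight a (m + w1 - w) x y * bulk_weight t (a * b) w1 y e' g *
     G e' (m + w1 - w + y - x)%N).
  under [RHS]eq_bigr do rewrite -yang_baxter //.
  rewrite [RHS]exchange_big /=; apply: eq_bigr => e _.
  rewrite exchange_big /=; apply: eq_bigr => h _.
  by rewrite mulr_sumr; apply: eq_bigr => e' _; ring.
rewrite exchange_big; apply: eq_bigr => w1 _.
rewrite exchange_big big_bool !big_bool -[LHS]/((_ + _) + (_ + _)).
rewrite [size (_ :: _)]/= sumbitsS [in RHS]addrC mulrDr /G !mulr_sumbits -!sumbitsD.
by apply: eq_sumbits => s' _ /=; ring.
Qed.

Fixpoint path_weight (a : nat -> R) (n : nat) (s : seq bool) : R :=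
  if n is n'.+1 then
    sumbits n' (fun s0 => path_weight a n' s0 * row_weight (a n') (mkseq a n') true s0 s)
  else (s == [::])%:R.

Lemma path_weight_column (a : nat -> R) n s :
    (forall i j, 1 - t * (a i * a j) != 0) -> size s = n ->
  sumbits n (fun s' => path_weight a n s' * column_weight (mkseq a n) 0 s' s)
  = path_weight a n s.
Proof.
move=> u0; elim: n s => [|n IH] s sn.
  by case: s sn => //= _; rewrite /top_weight big_nil mulr1.
transitivity (sumbits n (fun s0 => path_weight a n s0 * sumbits n.+1 (fun s' =>
    row_weight (a n) (mkseq a n) true s0 s' * column_weight (mkseq a n.+1) 0 s' s))).
  under [RHS]eq_sumbits do rewrite mulr_sumbits.
  rewrite exchange_sumbits; apply: eq_sumbits => s' _.
  by rewrite mulr_sumbitsl; apply: eq_sumbits => s0 _; rewrite mulrA.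
transitivity (sumbits n (fun s0 => path_weight a n s0 * sumbits n (fun s1 =>
    column_weight (mkseq a n) 0 s0 s1 * row_weight (a n) (mkseq a n) true s1 s))).
  apply: eq_sumbits => s0 sz0; congr (_ * _).
  have := @row_column_exchange (a n) (mkseq a n) 0 true s0 s.
  rewrite size_mkseq -mkseqS big_bool /= => -> //.
    (* At [m = 0] and [w = true] the weight of [w1 = false] contains [1 - t ^+ 0 = 0], and that of
       [w1 = true] is 1: the crossing disappears. *)
    by rewrite /dual_boson_weight /= expr0 subrr mulr0 mul0r addr0 mul1r.
  by move=> _ /mapP[i _ ->].
under eq_sumbits do rewrite mulr_sumbits.
rewrite exchange_sumbits /=; apply: eq_sumbits => s1 sz1.
by rewrite -[in RHS]IH // mulr_sumbitsl; apply: eq_sumbits => s0 _; rewrite mulrA.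
Qed.

End BosonColumn.

(** * Convergence of the column evolution *)

Lemma sumbits_ge0 (R : realType) n (F : seq bool -> R) :
  (forall s, size s = n -> 0 <= F s) -> 0 <= sumbits n F.
Proof.
elim: n F => [|n IH] F F0 /=; first exact: F0.
by rewrite addr_ge0 // IH // => s sn; apply: F0; rewrite /= sn.
Qed.

Lemma le_sumbits (R : realType) n (F G : seq bool -> R) :
  (forall s, size s = n -> F s <= G s) -> sumbits n F <= sumbits n G.
Proof.
elim: n F G => [|n IH] F G FG /=; first exact: FG.
by rewrite lerD // IH // => s sn; apply: FG; rewrite /= sn.
Qed.

Lemma cvg_sumbits (R : realType) n (F : nat -> seq bool -> R) (l : seq bool -> R) :
  (forall s, size s = n -> F ^~ s @ \oo --> l s) ->
  (fun k => sumbits n (F k)) @ \oo --> sumbits n l.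
Proof.
elim: n F l => [|n IH] F l Fl /=; first exact: Fl.
by apply: cvgD; apply: IH => s sn; apply: Fl; rewrite /= sn.
Qed.

(* The sum of all partial sums of [s]. *)
Fixpoint potential (s : seq bool) : nat :=
  if s is x :: s' then x * (size s').+1 + potential s' else 0.

(** * Triangularity, positivity and diagonal of the column matrix *)

Section ColumnWeightBounds.
Variables (R : realType) (t : R).
Hypothesis ht : 0 <= t < 1.
Implicit Types (a b : R) (al : seq R) (s : seq bool).

Let t_exp_le1 k : t ^+ k <= 1.
Proof. by case/andP: ht => t0 /ltW t1; rewrite exprn_ile1. Qed.

Lemma boson_weight_neq0 a m (x y : bool) : boson_weight t a m x y != 0 -> (x <= m + y)%N.
Proof.
rewrite /boson_weight; case: x; case: y => //=; rewrite ?addn1 // addn0.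
by case: m => //; rewrite expr0 subrr eqxx.
Qed.

Lemma column_weight_size al m s s' : column_weight t al m s s' != 0 ->
  size s = size al /\ size s' = size al.
Proof.
elim: al m s s' => [|a al IH] m [|x s] [|y s'] //=; rewrite ?eqxx //.
by rewrite mulf_eq0 negb_or => /andP[_ /IH[-> ->]].
Qed.

Lemma column_weight_dominance al m s s' i : column_weight t al m s s' != 0 ->
  (count id (take i s) <= m + count id (take i s'))%N.
Proof.
elim: al m s s' i => [|a al IH] m [|x s] [|y s'] [|i] //=; rewrite ?eqxx //.
rewrite mulf_eq0 negb_or => /andP[/boson_weight_neq0 xm /(IH _ _ _ i)].
by move: (count _ _) (count _ _) => p q; lia.
Qed.

(** At [m = 0] this is strict triangularity off the diagonal. General [m] is for the induction:
    particles already present can raise each partial sum of [s] above that of [s'] by at most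
    [m]. *)
Lemma column_weight_potential al m s s' : column_weight t al m s s' != 0 ->
  (potential s <= m * size s + potential s')%N /\
  (m = 0%N -> potential s = potential s' -> s = s').
Proof.
elim: al m s s' => [|a al IH] m [|x s] [|y s'] //=; rewrite ?eqxx //.
rewrite mulf_eq0 negb_or => /andP[/boson_weight_neq0 xm cw].
have [sz sz'] := column_weight_size cw; have [le eqs] := IH _ _ _ cw.
rewrite sz sz' in le *; split; first by nia.
move=> m0 E; subst m; have m'0 : (0 + y - x = 0)%N by nia.
have xy : x = y by move: xm m'0; case: (x); case: (y).
by subst y; rewrite (eqs m'0) //; nia.
Qed.

Lemma column_weight_ge0 al m s s' : {in al, forall a, 0 <= a} ->
  0 <= column_weight t al m s s'.
Proof.
elim: al m s s' => [|a al IH] m [|x s] [|y s'] //= al0.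
  rewrite /top_weight; case: ifP => // _.
  by rewrite prodr_ge0 // => k _; rewrite subr_ge0.
rewrite mulr_ge0 ?IH //; last by move=> b bal; rewrite al0 // inE bal orbT.
by rewrite /boson_weight; do 2?case: ifP => _ //; rewrite ?subr_ge0 // al0 ?mem_head.
Qed.

Lemma column_weight_diag al s : size s = size al ->
  column_weight t al 0 s s = \prod_(p <- zip al s) p.1 ^+ p.2.
Proof.
elim: al s => [|a al IH] [|x s] //=; first by rewrite /top_weight !big_nil.
move=> [sz]; rewrite big_cons addnK IH //=; congr (_ * _).
by rewrite /boson_weight; case: x.
Qed.

Lemma column_weight_diag_false al : column_weight t al 0 (nseq (size al) false) (nseq (size al) false) = 1.
Proof.
by elim: al => [|a al IH] /=; rewrite ?mul1r //= /top_weight big_nil.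
Qed.

Lemma column_weight_diag_lt1 al s : {in al, forall a, 0 < a < 1} ->
  size s = size al -> s != nseq (size al) false -> column_weight t al 0 s s < 1.
Proof.
move=> al01 sz; rewrite column_weight_diag //.
have le1 : forall al s, {in al, forall a, 0 < a < 1} ->
    0 <= \prod_(p <- zip al s) p.1 ^+ p.2 <= 1.
  elim=> [|a l IH] [|x u] l01; rewrite ?big_nil ?lexx ?ler01 //= big_cons /=.
  have /andP[p0 p1] : 0 <= \prod_(p <- zip l u) p.1 ^+ p.2 <= 1.
    by apply: IH => b bl; apply: l01; rewrite inE bl orbT.
  have /andP[a0 a1] := l01 a (mem_head _ _).
  by rewrite mulr_ge0 ?exprn_ge0 ?mulr_ile1 ?exprn_ge0 ?exprn_ile1 // ltW.
elim: al s al01 sz => [|a al IH] [|x s] //= al01 [sz].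
have al01' : {in al, forall a, 0 < a < 1}.
  by move=> b bl; apply: al01; rewrite inE bl orbT.
have /andP[p0 p1] := le1 _ s al01'; have /andP[a0 a1] := al01 a (mem_head _ _).
rewrite big_cons /= eqseq_cons; case: x => /= [_|]; last by rewrite mul1r; apply: IH.
by rewrite expr1; apply: le_lt_trans a1; rewrite ler_piMr // ltW.
Qed.

(** Once [f] vanishes at smaller potentials, the fixed-point equation at [s] reads [f s = f s * d],
    with a diagonal entry [d < 1] unless [s] is the empty string. *)
Lemma column_fixed_point0 al (f : seq bool -> R) :
    {in al, forall a, 0 < a < 1} ->
    (forall s, size s = size al ->
       sumbits (size al) (fun s0 => f s0 * column_weight t al 0 s0 s) = f s) ->
    f (nseq (size al) false) = 0 ->
  forall s, size s = size al -> f s = 0.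
Proof.
move=> al01 fix_f f0 s; have [k] := ubnP (potential s).
elim: k s => // k IH s ks sz.
have [->//|s0] := eqVneq s (nseq (size al) false).
have : f s = f s * column_weight t al 0 s s.
  rewrite -{1}fix_f // -(sumbits_pred1 (fun s0 => f s0 * column_weight t al 0 s0 s) sz).
  apply: eq_sumbits => s1 sz1; case: eqP => // s1s.
  have [->|cw] := eqVneq (column_weight t al 0 s1 s) 0; first by rewrite mulr0.
  have [le eqs] := column_weight_potential cw.
  rewrite IH ?mul0r //; move: le; rewrite leq_eqVlt => /orP[/eqP E|lt].
    by case: s1s; apply: eqs.
  by rewrite mul0n add0n in lt; lia.
move/eqP; rewrite -{1}[f s]mulr1 -subr_eq0 -mulrBr mulf_eq0 => /orP[/eqP //|].
by rewrite subr_eq0 gt_eqF // column_weight_diag_lt1.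
Qed.

End ColumnWeightBounds.

(** * Iterating the column matrix from the empty string *)

Section Evolution.
Variables (R : realType) (t : R) (a : nat -> R) (n : nat).
Hypothesis ht : 0 <= t < 1.
Hypothesis ha : forall i, 0 < a i < 1.
Let al := mkseq a n.
Let zero := nseq n false.

(** This will be the total unnormalized mass of the chains with at most [M] columns whose first
    column is recorded by [s]. *)
Fixpoint evolution (M : nat) (s : seq bool) : R :=
  if M is M'.+1 then sumbits n (fun s0 => evolution M' s0 * column_weight t al 0 s0 s)
  else (s == zero)%:R.

Let al01 : {in al, forall b, 0 < b < 1}.
Proof. by move=> _ /mapP[i _ ->]. Qed.

Let al0 : {in al, forall b, 0 <= b}.
Proof. by move=> b /al01 /andP[/ltW]. Qed.

Let aa_lt1 i j : a i * a j < 1.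
Proof.
have /andP[ai0 ai1] := ha i; have /andP[aj0 aj1] := ha j.
by rewrite mulr_ilt1 // ltW.
Qed.

Let taa_lt1 i j : t * (a i * a j) < 1.
Proof.
have /andP[ai0 ai1] := ha i; have /andP[aj0 aj1] := ha j; case/andP: ht => t0 t1.
by rewrite mulr_ilt1 // mulr_ge0 // ltW.
Qed.

Lemma bulk_weight_ge0 u w x e h : 0 <= u -> u < 1 -> t * u < 1 -> 0 <= bulk_weight t u w x e h.
Proof.
move=> u0 u1 tu1; case/andP: ht => t0 t1.
have [A0 [B0 C0]] : 0 <= 1 - u /\ 0 <= 1 - t /\ 0 <= (1 - t * u)^-1.
  by rewrite invr_ge0 !subr_ge0 !ltW.
by case: w; case: x; case: e; case: h => //=; rewrite ?mulr_ge0.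
Qed.

Lemma row_weight_ge0 j k w s s' : 0 <= row_weight t (a j) (mkseq a k) w s s'.
Proof.
have : {in mkseq a k, forall b, exists i, b = a i}.
  by move=> _ /mapP[i _ ->]; exists i.
elim: (mkseq a k) w s s' => [|b l IH] w [|x s] [|h s'] // H.
  by case: s' => // /=; rewrite ler0n.
have [i ->] := H b (mem_head _ _).
have ai := ha i; have aj := ha j.
rewrite /= addr_ge0 // mulr_ge0 ?bulk_weight_ge0 ?IH //;
  try by [move=> c cl; apply: H; rewrite inE cl orbT];
  by rewrite mulr_ge0 // ltW //; [case/andP: ai|case/andP: aj].
Qed.

Lemma path_weight_ge0 k s : 0 <= path_weight t a k s.
Proof.
elim: k s => [|k IH] s /=; first exact: ler0n.
by apply: sumbits_ge0 => s0 _; rewrite mulr_ge0 // row_weight_ge0.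
Qed.

(** With no path leaving upwards, the path entering from the west can only go straight to the
    corner, where it is absorbed, and no path can come from below. *)
Lemma row_weight_false b l s : size s = size l ->
  row_weight t b l true s (nseq (size l).+1 false) =
  if s == nseq (size s) false then
    \prod_(c <- l) ((1 - c * b) / (1 - t * (c * b))) else 0.
Proof.
elim: l s => [|c l IH] [|x s] //; first by rewrite /= big_nil.
move=> [sz].
case: x; rewrite /= -/(nseq (size l).+1 false) ?mul0r ?addr0 // IH // big_cons eqseq_cons.
by case: ifP; rewrite ?mulr0.
Qed.

Lemma path_weight_false k : path_weight t a k (nseq k false) =
  \prod_(j < k) \prod_(i < j) ((1 - a i * a j) / (1 - t * (a i * a j))).
Proof.
elim: k => [|k IH]; first by rewrite /= big_ord0.
rewrite big_ord_recr /= -IH -/(nseq k.+1 false).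
rewrite (eq_sumbits (G := fun s => if s == nseq k false then path_weight t a k s *
   \prod_(i < k) ((1 - a i * a k) / (1 - t * (a i * a k))) else 0)).
  by rewrite sumbits_pred1 ?size_nseq.
move=> s sz; have := @row_weight_false (a k) (mkseq a k) s.
rewrite size_mkseq sz => -> //; case: ifP => _; rewrite ?mulr0 // big_map.
by rewrite -(big_mkord xpredT (fun i => (1 - a i * a k) / (1 - t * (a i * a k))))
  /index_iota subn0.
Qed.

Lemma path_weight_false_gt0 : 0 < path_weight t a n zero.
Proof.
rewrite path_weight_false prodr_gt0 // => j _; rewrite prodr_gt0 // => i _.
by rewrite divr_gt0 // subr_gt0.
Qed.

Lemma evolution_fixed s : size s = n ->
  sumbits n (fun s0 => path_weight t a n s0 * column_weight t al 0 s0 s) = path_weight t a n s.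
Proof.
by apply: path_weight_column => i j; rewrite subr_eq0 gt_eqF.
Qed.

Lemma evolution_le M s : size s = n ->
  path_weight t a n zero * evolution M s <= path_weight t a n s.
Proof.
elim: M s => [|M IH] s sz /=.
  by case: eqP => [->|_]; rewrite ?mulr1 // mulr0 path_weight_ge0.
rewrite -[leRHS]evolution_fixed // mulr_sumbits; apply: le_sumbits => s0 sz0.
by rewrite mulrA ler_wpM2r ?IH // column_weight_ge0.
Qed.

Lemma evolution_leS M s : size s = n -> evolution M s <= evolution M.+1 s.
Proof.
elim: M s => [|M IH] s sz.
  rewrite /= -[zero]/(nseq n false) (eq_sumbits (G := fun s0 => if s0 == zero then
     column_weight t al 0 s0 s else 0)); last first.
    by move=> s0 _; case: eqP => _; rewrite ?mul1r ?mul0r.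
  rewrite sumbits_pred1 ?size_nseq //; case: eqP => [->|_]; last exact: column_weight_ge0.
  have := column_weight_diag_false t al.
  by rewrite size_mkseq => ->.
rewrite [leRHS]/= [leLHS]/=; apply: le_sumbits => s0 sz0.
by rewrite ler_wpM2r ?IH // column_weight_ge0.
Qed.

Lemma evolution_cvg s : size s = n ->
  evolution ^~ s @ \oo --> path_weight t a n s / path_weight t a n zero.
Proof.
move=> sz; pose c := path_weight t a n zero; have c0 : 0 < c := path_weight_false_gt0.
pose l s := limn (evolution ^~ s).
have cvl s' : size s' = n -> evolution ^~ s' @ \oo --> l s'.
  move=> sz'; apply: nondecreasing_is_cvgn.
    by apply/nondecreasing_seqP => k; apply: evolution_leS.
  exists (path_weight t a n s' / c) => _ [k _ <-].
  by rewrite ler_pdivlMr // mulrC evolution_le.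
have lE s' : size s' = n -> sumbits n (fun s0 => l s0 * column_weight t al 0 s0 s') = l s'.
  move=> sz'; suff H : evolution ^~ s' @ \oo -->
      sumbits n (fun s0 => l s0 * column_weight t al 0 s0 s').
    by rewrite [RHS]/l (cvg_lim _ H).
  rewrite -(cvg_shiftS (evolution ^~ s')) /=.
  by apply: cvg_sumbits => s0 sz0; apply: cvgMl; apply: cvl.
(* Monotonicity bounds this entry below by 1, comparison with the path string vector bounds it above
   by 1. *)
have ev0 k : evolution k zero = 1.
  elim: k => [|k IH]; first by rewrite /= eqxx.
  apply/eqP; rewrite eq_le -{2}IH evolution_leS ?size_nseq // andbT.
  by rewrite -(ler_pM2l c0) mulr1 evolution_le ?size_nseq.
have l0 : l zero = 1.
  by rewrite /l (_ : evolution ^~ zero = cst 1) ?lim_cst //; apply/funext => k; rewrite ev0.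
suff -> : path_weight t a n s / c = l s by exact: cvl.
(* This difference is fixed by the column matrix and vanishes at the empty string. *)
have : path_weight t a n s - c * l s = 0.
  have szal : size al = n by rewrite size_mkseq.
  have := @column_fixed_point0 _ _ ht al (fun s => path_weight t a n s - c * l s) al01.
  rewrite szal; apply => // [s' sz'|]; last by rewrite l0 mulr1 subrr.
  rewrite -[in RHS]evolution_fixed // -[in RHS]lE // mulr_sumbits -sumbitsB.
  by apply: eq_sumbits => s0 _; rewrite mulrBl mulrA.
by move/subr0_eq => ->; rewrite mulrC mulKf // gt_eqF.
Qed.

End Evolution.

(** * Chains of partitions *)

Lemma col_gt lam i j : (i < col lam j)%N = (j < part lam i)%N.
Proof.
rewrite /col /part; have := part_sorted lam.
elim: (lam : seq nat) i => [|k l IH] i kl /=; first by rewrite nth_nil.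
have min := order_path_min (rev_trans leq_trans) kl.
case: i => [|i] /=.
  have [jk|kj] := ltnP j k; first by rewrite add1n.
  rewrite add0n -has_count; apply/hasPn => x xl; rewrite -leqNgt.
  by apply: leq_trans kj; have /allP/(_ _ xl) := min.
rewrite -IH ?(path_sorted kl) //; have [jk|kj] := ltnP j k; first by rewrite add1n.
have -> : count (leq j.+1) l = 0%N.
  apply/eqP; rewrite eqn0Ngt -has_count; apply/hasPn => x xl; rewrite -leqNgt.
  by apply: leq_trans kj; have /allP/(_ _ xl) := min.
by rewrite !ltn0.
Qed.

Lemma included_col mu lam : (forall j, (col mu j <= col lam j)%N) -> included mu lam.
Proof.
move=> H i; rewrite leqNgt; apply/negP; rewrite -col_gt => lt.
have := leq_trans lt (H _).
by rewrite col_gt ltnn.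
Qed.

Definition rem_col (lam : intpart) : intpart := part_of_columns (behead (columns lam)).

Lemma col_rem_col lam j : col (rem_col lam) j = col lam j.+1.
Proof.
rewrite col_part_of_columns ?nth_behead ?nth_columns //.
by have /andP[+ _] := columns_wf lam; case: (columns lam) => //= c cs /path_sorted.
Qed.

Fixpoint bitseqs (n : nat) : seq (seq bool) :=
  if n is n'.+1 then map (cons false) (bitseqs n') ++ map (cons true) (bitseqs n')
  else [:: [::]].

Lemma sumbits_bitseqs (R : zmodType) n (F : seq bool -> R) :
  sumbits n F = \sum_(s <- bitseqs n) F s.
Proof.
elim: n F => [|n IH] F /=; first by rewrite big_seq1.
by rewrite big_cat !big_map !IH.
Qed.

Lemma mem_bitseqs n s : (s \in bitseqs n) = (size s == n).
Proof.
elim: n s => [|n IH] s /=; first by rewrite inE size_eq0.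
rewrite mem_cat; apply/orP/idP => [[] /mapP[u]|].
- by rewrite IH => /eqP un ->; rewrite /= un.
- by rewrite IH => /eqP un ->; rewrite /= un.
case: s => [|[] s] // sn; [right|left]; by apply: map_f; rewrite IH.
Qed.

Lemma bitseqs_uniq n : uniq (bitseqs n).
Proof.
elim: n => //= n IH; rewrite cat_uniq !map_inj_uniq ?IH /= ?andbT;
  try by move=> u v [].
by apply/hasPn => _ /mapP[u _ ->]; apply/mapP => -[].
Qed.

Definition ones (i : nat) (s : seq bool) : nat := count id (take i s).

Lemma onesS i s : ones i.+1 s = (ones i s + nth false s i)%N.
Proof.
rewrite /ones; elim: s i => [|x s IH] [|i] //=; first by rewrite take0 /= addn0.
by rewrite IH addnA.
Qed.

Lemma ones_inj n s s' : size s = n -> size s' = n ->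
  (forall i, (i <= n)%N -> ones i s = ones i s') -> s = s'.
Proof.
move=> sn sn' E; apply: (@eq_from_nth _ false); rewrite sn // => i ilt.
have := E _ ilt; rewrite !onesS (E i) ?(ltnW ilt) // => /addnI.
by case: (nth _ s _); case: (nth _ s' _).
Qed.

(** * Effect of a new first column on the weights *)

Section StripWeights.
Variables (R : realType) (t : R).
Hypothesis ht : 0 <= t < 1.

(** [p] and [p0] are the lengths already reached by the column and by its right neighbour, so
    [p - p0] is the current particle number; domination makes these subtractions honest along the
    whole chain. *)
Lemma prod_strip_weight (al : seq R) s0 s p0 p :
    size s0 = size al -> size s = size al ->
    (forall i, (i <= size al)%N -> (p0 + ones i s0 <= p + ones i s)%N) ->
  (\prod_(i < size al) strip_weight t al`_i (p + ones i.+1 s) (p0 + ones i.+1 s0)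
     (p + ones i s) (p0 + ones i s0)) *
  top_weight t (p + count id s - (p0 + count id s0)) =
  column_weight t al (p - p0) s0 s.
Proof.
elim: al s0 s p0 p => [|a al IH] [|x s0] [|y s] //= p0 p.
  by move=> _ _ _; rewrite big_ord0 !addn0 mul1r.
move=> [sz0] [sz] dom; have d0 := dom 0%N isT; have d1 := dom 1%N isT.
rewrite /ones /= !addn0 in d0 d1; rewrite !take0 /= !addn0 in d1.
have m' : (p - p0 + y - x = p + y - (p0 + x))%N by lia.
rewrite m' -(IH s0 s) //; last first.
  by move=> i ial; have := dom i.+1 ial; rewrite /ones /= !addnA.
rewrite big_ord_recl /= /ones /= !take0 /= !addn0 !addnA -mulrA; congr (_ * _); last first.
  by congr (_ * _); apply: eq_bigr => i _; rewrite /bump /= !add0n !add1n !addnA.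
rewrite /strip_weight /boson_weight; case: (y) => /=.
  rewrite addn1 leqnSn leqnn /= subSnn expr1 andbF.
  by rewrite eqn_leq ltnn /= mulr1.
rewrite addn0 leqnn leqnSn /= subnn expr0 mul1r eqxx andbT.
by case: (x); rewrite ?addn1 ?eqxx // addn0 eqn_leq ltnn andbF.
Qed.

Lemma strip_weight_ge0 a d d1 e e1 : 0 <= a -> 0 <= strip_weight t a d d1 e e1.
Proof.
move=> a0; rewrite /strip_weight; case: ifP => // _; rewrite mulr_ge0 ?exprn_ge0 //.
by case/andP: ht => t0 /ltW t1; case: ifP => // _; rewrite subr_ge0 exprn_ile1.
Qed.

Lemma skew_coef_ge0 a lam mu : 0 <= a -> 0 <= skew_coef t lam a mu.
Proof. by move=> a0; apply: prodr_ge0 => j _; apply: strip_weight_ge0. Qed.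

Lemma skew_coef_strip a lam mu j : skew_coef t lam a mu != 0 ->
  (col mu j <= col lam j <= (col mu j).+1)%N.
Proof.
rewrite (@skew_coefE _ _ (maxn j.+1 (maxn (part lam 0) (part mu 0)))); last 2 first.
- by rewrite !leq_max leqnn !orbT.
- by rewrite !leq_max leqnn !orbT.
have jlt : (j < maxn j.+1 (maxn (part lam 0) (part mu 0)))%N by rewrite leq_max leqnn.
rewrite (bigD1 (Ordinal jlt)) //= mulf_eq0 negb_or => /andP[+ _].
by rewrite /strip_weight; case: ifP => //; rewrite eqxx.
Qed.

Lemma skew_coef_add_col a c lam d mu : (len lam <= c)%N -> (len mu <= d)%N ->
  skew_coef t (add_col c lam) a (add_col d mu) =
  strip_weight t a c (len lam) d (len mu) * skew_coef t lam a mu.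
Proof.
move=> lc md; pose M := maxn (part lam 0) (part mu 0).
rewrite (@skew_coefE _ _ M.+1); last 2 first.
- by rewrite part_add_col; case: ifP => // _; rewrite ltnS leq_maxl.
- by rewrite part_add_col; case: ifP => // _; rewrite ltnS leq_maxr.
rewrite big_ord_recl /= !col_add_col0 // !col_add_colS !col0; congr (_ * _).
by apply: eq_bigr => j _; rewrite /bump /= !add1n !col_add_colS.
Qed.

Definition even_b_el lam : R := b_el t lam * (transpose_even lam)%:R.

Lemma columns_add_col c lam : (len lam <= c)%N -> (0 < c)%N ->
  columns (add_col c lam) = c :: columns lam.
Proof.
move=> lc c0; rewrite !columnsE part_add_col -[c == 0%N]negbK -lt0n c0 /=.
rewrite /mkseq /= col_add_col0 // -[1%N]addn0 iotaDl -map_comp; congr (_ :: _).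
by apply: eq_map => j; rewrite /= add1n col_add_colS.
Qed.

(** The new column shifts the old multiplicities by one and creates the multiplicity [c - len lam]
    of the part 1. If the old columns are even, so is [len lam], and the parity of [c] is that of
    this multiplicity. *)
Lemma even_b_el_add_col c lam : (len lam <= c)%N ->
  even_b_el (add_col c lam) = top_weight t (c - len lam) * even_b_el lam.
Proof.
move=> lc; rewrite /even_b_el /transpose_even !transposeE.
case: (posnP c) => [c0|c0].
  subst c; have lam0 : part lam 0 = 0%N by apply/eqP; rewrite -leqn0 -col_eq0 col0 -leqn0.
  have -> : add_col 0 lam = lam.
    apply: col_inj => -[|j]; first by rewrite col_add_col0 // col0; lia.
    have z k : col lam k = 0%N by apply/eqP; rewrite col_eq0 lam0.
    by rewrite col_add_colS !z.
  by rewrite sub0n /top_weight /= big_nil mul1r.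
rewrite columns_add_col //=.
case: (boolP (all _ (columns lam))) => ev; last by rewrite andbF !mulr0.
have evl : ~~ odd (len lam).
  rewrite -col0 -nth_columns; case: (columns lam) ev => //= k l /andP[] //.
rewrite andbT !mulr1 /top_weight oddB // (negPf evl) addbF.
case: (odd c); first by rewrite mulr0 mul0r.
rewrite mulr1 /b_el part_add_col -[c == 0%N]negbK -lt0n c0 /=.
rewrite big_nat_recl // mult_col col_add_col0 // col_add_colS col0; congr (_ * _).
rewrite big_add1 [in RHS]big_add1 /=; apply: eq_bigr => i _.
by rewrite !mult_col !col_add_colS.
Qed.

Lemma even_b_el_ge0 lam : 0 <= even_b_el lam.
Proof.
rewrite mulr_ge0 ?ler0n //; apply: prodr_ge0 => i _; apply: prodr_ge0 => k _.
by case/andP: ht => t0 /ltW t1; rewrite subr_ge0 exprn_ile1.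
Qed.

End StripWeights.

(** * Enumeration of chains by their columns *)

Section Chains.
Variable n : nat.
Implicit Types (lam : chain n) (s : seq bool).

Definition add_col_chain s lam : chain n := [ffun i : 'I_n.+1 => add_col (ones i s) (lam i)].

Lemma add_col_chain_inj s : injective (add_col_chain s).
Proof.
move=> lam mu E; apply/ffunP => i; apply: col_inj => j.
have /ffunP/(_ i) := E; rewrite !ffunE => /(congr1 (fun nu => col nu j.+1)).
by rewrite !col_add_colS.
Qed.

Definition dominated s0 s := [forall i : 'I_n.+1, (ones i s0 <= ones i s)%N].

(** Columns may be empty, so [M] only bounds their number and the enumerations grow with [M].
    Domination says that at every time the new column is at least as long as the next one. *)
Fixpoint bounded_chains (M : nat) (s : seq bool) : seq (chain n) :=
  if M is M'.+1 then
    [seq add_col_chain s lam | s0 <- [seq s0 <- bitseqs n | dominated s0 s],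
                               lam <- bounded_chains M' s0]
  else if s == nseq n false then [:: [ffun=> empty_part]] else [::].

Definition strip_chain (M : nat) s lam : Prop :=
  [/\ forall j, col (lam ord0) j = 0%N,
      forall i : 'I_n.+1, col (lam i) 0 = ones i s,
      forall i : 'I_n.+1, (part (lam i) 0 <= M)%N &
      forall (i : 'I_n) j, (col (lam (inord i)) j <= col (lam (inord i.+1)) j
                              <= (col (lam (inord i)) j).+1)%N].

Lemma bounded_chainsP M s lam : size s = n ->
  reflect (strip_chain M s lam) (lam \in bounded_chains M s).
Proof.
move=> sn; elim: M s sn lam => [|M IH] s sn lam /=.
  have col_empty j : col empty_part j = 0%N by [].
  case: eqP => [->|sneq]; rewrite ?inE; last first.
    apply: ReflectF => -[_ c0 p0 _]; apply: sneq; apply: (ones_inj sn).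
      by rewrite size_nseq.
    move=> i ilt; have := c0 (inord i); rewrite inordK // => <-.
    rewrite (_ : ones _ _ = 0%N); last first.
      by rewrite /ones; apply/eqP; rewrite eqn0Ngt -has_count; apply/hasPn => x /mem_take /nseqP[->].
    by apply/eqP; rewrite col_eq0.
  have ones0 i : ones i (nseq n false) = 0%N.
    by rewrite /ones; apply/eqP; rewrite eqn0Ngt -has_count; apply/hasPn => x /mem_take /nseqP[->].
  apply: (iffP eqP) => [->|[_ _ p0 _]].
    by split=> *; rewrite ?ffunE ?ones0.
  apply/ffunP => i; rewrite ffunE; apply: col_inj => j; rewrite col_empty.
  by apply/eqP; rewrite col_eq0 (leq_trans (p0 i)).
apply: (iffP allpairsPdep) => [[s0 [lam0 [s0in lam0in ->]]]|[c00 c0 pM st]].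
  move: s0in; rewrite mem_filter mem_bitseqs => /andP[/forallP dom /eqP sn0].
  have [d00 d0 dM dst] := IH _ sn0 _ lam0in.
  have le i : (len (lam0 i) <= ones i s)%N by rewrite -col0 d0 dom.
  split.
  - move=> [|j]; rewrite ffunE; first by rewrite col_add_col0 // /ones take0.
    by rewrite col_add_colS.
  - by move=> i; rewrite ffunE col_add_col0.
  - by move=> i; rewrite ffunE part_add_col; case: ifP => // _; rewrite ltnS.
  - move=> i [|j]; rewrite !ffunE; last by rewrite !col_add_colS.
    rewrite !col_add_col0 // !inordK ?ltnS ?ltn_ord ?(ltnW (ltn_ord i)) // onesS.
    by case: (nth _ _ _); rewrite ?addn1 ?addn0 leqnn leqnSn.
(* Peeling off the first column leaves a chain recorded by the growth of the second column. *)
pose s0 := mkseq (fun i => col (lam (inord i.+1)) 1 != col (lam (inord i)) 1) n.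
have ones_s0 i : (i <= n)%N -> ones i s0 = col (lam (inord i)) 1.
  elim: i => [|i IHi] ilt.
    rewrite /ones take0 /= (_ : inord 0 = ord0) ?c00 //.
    by apply: val_inj; rewrite /= inordK.
  rewrite onesS IHi ?(ltnW ilt) // nth_mkseq //.
  have := st (Ordinal ilt) 1%N => /=.
  by case: eqP => /=; lia.
pose lam0 : chain n := [ffun i => rem_col (lam i)].
exists s0, lam0; split.
- rewrite mem_filter mem_bitseqs size_mkseq eqxx andbT; apply/forallP => i.
  have ile : (i <= n)%N := ltn_ord i.
  by rewrite ones_s0 // inord_val -c0 col_noninc.
- apply/IH; first by rewrite size_mkseq.
  split.
  + by move=> j; rewrite ffunE col_rem_col.
  + move=> i; have ile : (i <= n)%N := ltn_ord i.
    by rewrite ffunE col_rem_col ones_s0 // inord_val.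
  + move=> i; rewrite ffunE -col_eq0 col_rem_col col_eq0; exact: pM.
  + by move=> i j; rewrite !ffunE !col_rem_col.
- apply/ffunP => i; rewrite !ffunE; apply: col_inj => -[|j].
    by rewrite col_add_col0 // -col0 col_rem_col -c0 col_noninc.
  by rewrite col_add_colS col_rem_col.
Qed.

Lemma bounded_chains_uniq M s : uniq (bounded_chains M s).
Proof.
elim: M s => [|M IH] s /=; first by case: ifP.
apply: allpairs_uniq_dep.
- by rewrite filter_uniq // bitseqs_uniq.
- by move=> s0 _; apply: IH.
move=> p q /allpairsPdep[s1 [lam1 [s1in lam1in ->]]].
move=> /allpairsPdep[s2 [lam2 [s2in lam2in ->]]] /= /add_col_chain_inj lamE.
subst lam2; suff -> : s1 = s2 by [].
move: s1in s2in; rewrite !mem_filter !mem_bitseqs => /andP[_ /eqP n1] /andP[_ /eqP n2].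
have [_ c1 _ _] := bounded_chainsP _ _ n1 lam1in.
have [_ c2 _ _] := bounded_chainsP _ _ n2 lam2in.
apply: (ones_inj n1 n2) => i ilt.
by have := c1 (inord i); rewrite c2 !inordK.
Qed.

End Chains.

(** * Total mass of the chains and the half-space process *)

Section ChainMass.
Variables (R : realType) (t : R) (n : nat) (a : 'I_n -> R).
Hypothesis ht : 0 <= t < 1.
Hypothesis ha : forall i, 0 < a i < 1.

(* Extended by an arbitrary value in (0, 1). *)
Definition extend_param (i : nat) : R := oapp a 2^-1 (insub i).

Lemma extend_paramE (i : 'I_n) : extend_param i = a i.
Proof. by rewrite /extend_param valK. Qed.

Lemma extend_param01 i : 0 < extend_param i < 1.
Proof.
rewrite /extend_param; case: insub => //=.
by rewrite invr_gt0 ltr0n /= invf_lt1 ?ltr0n // ltr1n.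
Qed.

Let al := mkseq extend_param n.

Definition chain_mass (lam : chain n) : R :=
  (\prod_(i < n) skew_coef t (lam (inord i.+1)) (a i) (lam (inord i))) *
  even_b_el t (lam ord_max).

Lemma chain_mass_ge0 lam : 0 <= chain_mass lam.
Proof.
rewrite mulr_ge0 ?even_b_el_ge0 //; apply: prodr_ge0 => i _.
by apply: skew_coef_ge0 => //; have /andP[/ltW] := ha i.
Qed.

Lemma HL_massE lam : HL_mass t a lam = chain_mass lam / Phi t a.
Proof.
rewrite /HL_mass /chain_mass /even_b_el.
under eq_bigr do rewrite HL_skewPE //.
by rewrite -!mulrA; congr (_ * _); rewrite mulrC -mulrA.
Qed.

(** Each one-variable skew function and the boundary factor split off the contribution of the first
    column; together these form one entry of the column matrix. *)
Lemma chain_mass_add_col M s0 s lam : size s0 = n -> size s = n ->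
    dominated n s0 s -> strip_chain M s0 lam ->
  chain_mass (add_col_chain s lam) = column_weight t al 0 s0 s * chain_mass lam.
Proof.
move=> sz0 sz /forallP dom [_ c0 _ _].
have len0 i : len (lam i) = ones i s0 by rewrite -col0 c0.
have szal : size al = n by rewrite size_mkseq.
have onesn u : size u = n -> ones n u = count id u by move=> <-; rewrite /ones take_size.
have -> : column_weight t al 0 s0 s =
    (\prod_(i < n) strip_weight t (a i) (ones i.+1 s) (ones i.+1 s0) (ones i s) (ones i s0))
    * top_weight t (count id s - count id s0).
  have := @prod_strip_weight R t ht al s0 s 0 0; rewrite szal subn0 !add0n => <- //.
    congr (_ * _); apply: eq_bigr => i _.
    by rewrite /al nth_mkseq // extend_paramE !add0n.
  by move=> i ilt; have := dom (inord i); rewrite inordK.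
rewrite /chain_mass ffunE even_b_el_add_col ?len0 ?dom //=.
rewrite !onesn // -!mulrA [in RHS]mulrCA [LHS]mulrCA; congr (_ * _).
rewrite [RHS]mulrA -big_split /=; congr (_ * _); apply: eq_bigr => i _.
rewrite !ffunE skew_coef_add_col ?len0 ?dom // !inordK ?ltnS ?ltn_ord //.
exact: ltnW.
Qed.

Lemma evolution_chains M s : size s = n ->
  evolution t extend_param n M s = \sum_(lam <- bounded_chains n M s) chain_mass lam.
Proof.
elim: M s => [|M IH] s sz /=.
  case: eqP => _; last by rewrite big_nil.
  rewrite big_seq1 /chain_mass big1 => [|i _].
    rewrite /even_b_el ffunE /b_el /transpose_even /transpose /=.
    by rewrite big_geq ?mulr1.
  rewrite !ffunE (@skew_coefE _ _ 0) //.
  by rewrite big_ord0.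
rewrite big_allpairs_dep big_filter sumbits_bitseqs big_mkcond.
rewrite [RHS]big_mkcond; apply: eq_big_seq => s0; rewrite mem_bitseqs => /eqP sz0 /=.
case: ifPn => dom.
  rewrite IH // mulr_suml; apply: eq_big_seq => lam lamin.
  by rewrite (chain_mass_add_col sz0 sz dom (elimT (bounded_chainsP _ _ sz0) lamin)) mulrC.
(* Strings not dominated by [s] are absent from the enumeration; their column weight is 0. *)
have [->|cw] := eqVneq (column_weight t al 0 s0 s) 0; first by rewrite mulr0.
by case/negP: dom; apply/forallP => i; apply: column_weight_dominance cw.
Qed.

Lemma Phi_gt0 : 0 < Phi t a.
Proof.
apply: prodr_gt0 => -[i j] _ /=; have /andP[ai0 ai1] := ha i; have /andP[aj0 aj1] := ha j.
case/andP: ht => t0 t1.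
have aa : a i * a j < 1 by rewrite mulr_ilt1 // ltW.
rewrite divr_gt0 // subr_gt0 // -mulrA mulr_ilt1 // mulr_ge0 // ltW //.
Qed.

Lemma path_weight_false_Phi : path_weight t extend_param n (nseq n false) = (Phi t a)^-1.
Proof.
rewrite path_weight_false /Phi -prodfV.
rewrite (prod_ltn_pairs (fun i j => ((1 - t * a i * a j) / (1 - a i * a j))^-1)).
apply: eq_bigr => j _; rewrite (big_ord_widen n (fun i => (1 - extend_param i * extend_param j) /
  (1 - t * (extend_param i * extend_param j))) (ltnW (ltn_ord j))) big_mkcond /=.
by apply: eq_bigr => i _; case: ifP => // _; rewrite !extend_paramE invf_div mulrA.
Qed.

(** A nonzero mass forces every column to grow by at most one box per step. Ascending chains outside
    the enumerations thus carry no mass. *)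
Lemma chain_mass_neq0 M lam s : ascending lam -> size s = n ->
    (forall i, part (lam i) 0 <= M)%N ->
    length_increments lam = [ffun i : 'I_n => nat_of_bool (nth false s i)] ->
    chain_mass lam != 0 ->
  strip_chain M s lam.
Proof.
move=> [l0 asc] sz lM incr; rewrite mulf_eq0 negb_or => /andP[nz _].
have st (i : 'I_n) j : (col (lam (inord i)) j <= col (lam (inord i.+1)) j
                              <= (col (lam (inord i)) j).+1)%N.
  by move/prodf_neq0: nz => /(_ i isT) /skew_coef_strip.
split=> //; first by move=> j; rewrite l0.
move=> i; have := ltn_ord i; rewrite ltnS.
rewrite -[in col _ _](inord_val i); elim: (val i) => [|k IH] kn.
  rewrite /ones take0 (_ : inord 0 = ord0) ?l0 //.
  by apply: val_inj; rewrite /= inordK.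
have /ffunP/(_ (Ordinal kn)) := incr; rewrite !ffunE /= -!col0 onesS -IH ?(ltnW kn) // => <-.
by have /= /andP[] := st (Ordinal kn) 0%N; lia.
Qed.

(** An infinite sum of nonnegative terms is the supremum of its finite subsums. Those over bounded
    enumerations are the [e M]; they converge to the path weight, because its entry at the empty
    string is the inverse of [Phi]. Any other finite subsum is at most some [e M]. *)
Lemma HL_prob_path_weight (s : 'I_n -> bool) :
  HL_prob t a [set lam | length_increments lam = [ffun i => nat_of_bool (s i)]]
  = (path_weight t extend_param n (mkseq (fun i => oapp s false (insub i)) n))%:E.
Proof.
set u := mkseq _ n; have sz : size u = n by rewrite size_mkseq.
have uE i : s i = nth false u i by rewrite nth_mkseq // valK.
have -> : [ffun i => nat_of_bool (s i)] = [ffun i : 'I_n => nat_of_bool (nth false u i)].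
  by apply/ffunP => i; rewrite !ffunE uE.
rewrite /HL_prob; set D := (X in esum X _).
pose e M := evolution t extend_param n M u / Phi t a.
have Phi0 : 0 <= (Phi t a)^-1 by rewrite invr_ge0 ltW // Phi_gt0.
have e_cvg : e @ \oo --> path_weight t extend_param n u.
  have := evolution_cvg ht extend_param01 sz.
  rewrite path_weight_false_Phi invrK => /(cvgMl (b := (Phi t a)^-1)).
  by rewrite mulfK // gt_eqF // Phi_gt0.
have e_le M : e M <= path_weight t extend_param n u.
  have := evolution_le ht extend_param01 M sz.
  by rewrite path_weight_false_Phi mulrC.
have subD M : [set` bounded_chains n M u] `<=` D.
  move=> lam /= /(bounded_chainsP _ _ sz)[c00 c0 _ st]; split.
    split; first by apply: col_inj => j; rewrite c00.
    by move=> i; apply: included_col => j; have /andP[] := st i j.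
  apply/ffunP => i; rewrite !ffunE -!col0 !c0 !inordK ?ltnS ?ltn_ord ?(ltnW (ltn_ord i)) //.
  by rewrite onesS addKn.
have eE M : (e M)%:E = (\sum_(lam \in [set` bounded_chains n M u]) (HL_mass t a lam)%:E)%E.
  rewrite -fsbig_seq ?bounded_chains_uniq // sumEFin /e evolution_chains // mulr_suml.
  by congr (_%:E); apply: eq_bigr => lam _; rewrite HL_massE.
apply/eqP; rewrite eq_le; apply/andP; split.
  apply: ge_ereal_sup => _ [X [finX XD] <-].
  have [M XM] : exists M, forall lam, X lam -> forall i, (part (lam i) 0 <= M)%N.
    exists (\max_(lam <- fset_set X) \max_i part (lam i) 0) => lam Xlam i.
    have lamX : lam \in fset_set X by rewrite in_fset_set // inE.
    rewrite (big_rem _ lamX) /= leq_max; apply/orP; left.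
    by rewrite (bigD1 i) //= leq_maxl.
  apply: (@le_trans _ _ (e M)%:E); last by rewrite lee_fin.
  (* Only the chains of nonzero mass in [X] are sure to be enumerated, hence the restriction to the
     support. *)
  rewrite eE fsbig_supp; apply: lee_fsum_nneg_subset.
  - exact: finite_setIl.
  - exact: finite_seq.
  - move=> lam; rewrite !inE /= => -[Xlam].
    rewrite HL_massE => /eqP; rewrite eqe mulf_eq0 negb_or => /andP[nz _].
    have [asc incr] := XD _ Xlam.
    by apply/bounded_chainsP => //; apply: chain_mass_neq0 => //; apply: XM.
  - move=> lam _; rewrite HL_massE lee_fin mulr_ge0 ?chain_mass_ge0 //.
have : (forall M, (e M)%:E <= \esum_(lam in D) (HL_mass t a lam)%:E)%E.
  move=> M; rewrite eE; apply: esum_ge.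
  by exists [set` bounded_chains n M u]; [split; [exact: finite_seq|exact: subD]|].
(* The sum is not yet known to be finite; if it is, the bound by it passes to the limit of [e]. *)
case: (\esum_(lam in D) _)%E => [r| |].
- move=> er; rewrite lee_fin; apply: (cvgr_to_le e_cvg).
  by apply: nearW => M; rewrite -lee_fin.
- by rewrite leey.
- by move=> /(_ 0%N).
Qed.

End ChainMass.

(** * The six-vertex model *)

Section AllSeqs.
Variable T : eqType.
Implicit Types (base l : seq T) (n : nat).

Fixpoint allseqs base n : seq (seq T) :=
  if n is n'.+1 then [seq x :: l | x <- base, l <- allseqs base n'] else [:: [::]].

Lemma mem_allseqs base n l : (l \in allseqs base n) = (size l == n) && all [in base] l.
Proof.
elim: n l => [|n IH] l /=; first by rewrite inE; case: l.
apply/allpairsP/andP => [[[x u] /= [xb]]|[]].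
  by rewrite IH => /andP[/eqP un ub] -> /=; rewrite un xb ub.
case: l => // x u /=; rewrite eqSS => un /andP[xb ub].
by exists (x, u); split=> //; rewrite IH un.
Qed.

Lemma allseqs_uniq base n : uniq base -> uniq (allseqs base n).
Proof.
move=> ub; elim: n => //= n IH; apply: allpairs_uniq => //.
by move=> [x u] [y v] _ _ /= [-> ->].
Qed.

Lemma big_allseqsS (R : zmodType) base n (F : seq T -> R) :
  \sum_(l <- allseqs base n.+1) F l = \sum_(x <- base) \sum_(l <- allseqs base n) F (x :: l).
Proof. by rewrite big_allpairs_dep. Qed.

Lemma big_allseqs_rcons (R : zmodType) base n (F : seq T -> R) :
  \sum_(l <- allseqs base n.+1) F l = \sum_(l <- allseqs base n) \sum_(x <- base) F (rcons l x).
Proof.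
elim: n F => [|n IH] F.
  by rewrite big_allseqsS /= big_seq1; apply: eq_bigr => x _; rewrite big_seq1.
rewrite big_allseqsS; under eq_bigr do rewrite IH.
by rewrite [RHS]big_allseqsS.
Qed.

End AllSeqs.

(** * Summing the six-vertex weights row by row *)

Section SixVertexRows.
Variables (R : realType) (t : R).

Let void : bool * bool := (false, false).
Definition states : seq (bool * bool) := enum {: bool * bool}.

Definition west_of (w : bool) (r : seq (bool * bool)) (x : nat) : bool :=
  if x is x'.+1 then (nth void r x').1 else w.

(* The weight of position [x] of a row whose bulk part has parameters [al],
   the row itself having the parameter [b]; [s] is the row below, and beyond the
   corner all edges must be empty. *)
Definition vertex_weight (al : seq R) (b : R) (w : bool) (s : seq bool)
    (r : seq (bool * bool)) (x : nat) : R :=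
  let o := nth void r x in
  if (x < size al)%N then bulk_weight t (al`_x * b) (west_of w r x) (nth false s x) o.1 o.2
  else if x == size al then corner_weight (west_of w r x) o.2 * (~~ o.1)%:R
  else (~~ o.1 && ~~ o.2)%:R.

Lemma sum_vertex_weight m al b w s (F : seq bool -> R) :
    (size al < m)%N -> (size al <= size s)%N ->
  \sum_(r <- allseqs states m)
    (\prod_(x < m) vertex_weight al b w s r x) * F (map snd r) =
  sumbits (size al).+1 (fun s' => row_weight t b al w (take (size al) s) s' *
                                  F (s' ++ nseq (m - (size al).+1) false)).
Proof.
elim: al m w s F => [|a al IH] [|m] // w s F.
  move=> _ _; rewrite big_allseqsS /states big_enum /= subSS subn0 take0.
  (* After the corner, only the entirely empty continuation has nonzero weight. *)
  have E o : \sum_(r <- allseqs (enum {: bool * bool}) m)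
      (\prod_(x < m.+1) vertex_weight [::] b w s (o :: r) x) * F (map snd (o :: r)) =
      corner_weight w o.2 * (~~ o.1)%:R * F (o.2 :: nseq m false).
    have nin : nseq m void \in allseqs (enum {: bool * bool}) m.
      by rewrite mem_allseqs size_nseq eqxx; apply/allP => z _; rewrite /= mem_enum.
    rewrite (big_rem _ nin) [X in _ + X = _]big_seq [X in _ + X = _]big1 /= ?addr0.
      rewrite big_ord_recl big1 ?mulr1 ?map_nseq //.
      by move=> x _; rewrite /vertex_weight /= nth_nseq if_same.
    move=> r; rewrite mem_rem_uniq ?allseqs_uniq ?enum_uniq // !inE mem_allseqs.
    move=> /andP[rn /andP[/eqP sr _]].
    have [x xm] : exists2 x : 'I_m, true & nth void r x != void.
      apply/exists_inP; apply: contraNT rn => /exists_inPn H; apply/eqP.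
      apply: (@eq_from_nth _ void); rewrite ?size_nseq ?sr // => i im.
      rewrite nth_nseq im; apply/eqP; have := H (Ordinal im) isT.
      by rewrite negbK.
    move=> rx; rewrite (bigD1 (lift ord0 x)) //= /vertex_weight /= /bump /= ?add1n /=.
    rewrite -negb_or (_ : (nth void r x).1 || (nth void r x).2) ?mul0r //.
    by case: (nth void r x) rx => -[] [].
  rewrite (eq_bigr (fun o => corner_weight w o.2 * (~~ o.1)%:R * F (o.2 :: nseq m false)));
    last by move=> o _; rewrite E.
  rewrite -(pair_bigA _ (fun e h => corner_weight w h * (~~ e)%:R * F (h :: nseq m false))) /=.
  rewrite !big_bool /= /corner_weight.
  by rewrite !(mulr0, mul0r, mulr1, add0r, addr0) addrC.
case: s => // p s; rewrite !ltnS => alm als.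
rewrite big_allseqsS /states big_enum.
have E o : \sum_(r <- allseqs (enum {: bool * bool}) m)
    (\prod_(x < m.+1) vertex_weight (a :: al) b w (p :: s) (o :: r) x) * F (map snd (o :: r)) =
    bulk_weight t (a * b) w p o.1 o.2 * sumbits (size al).+1
      (fun s' => row_weight t b al o.1 (take (size al) s) s' *
                 F (o.2 :: s' ++ nseq (m - (size al).+1) false)).
  have := IH m o.1 s (fun u => F (o.2 :: u)) alm als; rewrite /states => <-.
  rewrite mulr_sumr; apply: eq_bigr => r _; rewrite big_ord_recl -!mulrA.
  congr (_ * (_ * _)); apply: eq_bigr => x _.
  by rewrite /vertex_weight /= /bump /= !add1n ltnS eqSS /=; case: (val x).
rewrite (eq_bigr _ (fun o _ => E o)).
rewrite -(pair_bigA _ (fun e h => bulk_weight t (a * b) w p e h * sumbits (size al).+1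
      (fun s' => row_weight t b al e (take (size al) s) s' *
                 F (h :: s' ++ nseq (m - (size al).+1) false)))).
rewrite exchange_big big_bool !big_bool -[LHS]/((_ + _) + (_ + _)).
rewrite [size (_ :: _)]/= [RHS]sumbitsS [RHS]addrC !mulr_sumbits -!sumbitsD.
by apply: eq_sumbits => s' _; rewrite /= subSS; ring.
Qed.

Variables (a : nat -> R) (n : nat).

Definition row_product (y : nat) (s : seq bool) (r : seq (bool * bool)) : R :=
  \prod_(x < n) vertex_weight (mkseq a y) (a y) true s r x.

(** Summing the top row first turns [F] into a function of the string below it. At [y = 0] the index
    [y.-1] points to the row itself, harmlessly: the first row has no bulk vertex and reads no state
    from below. *)
Lemma sum_rows k (F : seq bool -> R) : (k < n)%N ->
  \sum_(l <- allseqs (allseqs states n) k.+1)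
     (\prod_(y < k.+1) row_product y (map snd (nth [::] l y.-1)) (nth [::] l y)) *
     F (map snd (nth [::] l k)) =
  sumbits k.+1 (fun s => path_weight t a k.+1 s * F (s ++ nseq (n - k.+1) false)).
Proof.
elim: k F => [|k IH] F kn.
  rewrite big_allseqsS.
  have := @sum_vertex_weight n [::] (a 0) true [::] F kn isT; rewrite [size _]/= => E.
  transitivity (sumbits 1 (fun s' => row_weight t (a 0) [::] true [::] s' *
                                  F (s' ++ nseq (n - 1) false))); last first.
    by apply: eq_sumbits => s _ /=; rewrite mul1r.
  rewrite -E; apply: eq_bigr => r _; rewrite /= big_seq1 big_ord_recl big_ord0 mulr1 /=.
  by congr (_ * _); apply: eq_bigr => x _; rewrite /vertex_weight.
rewrite big_allseqs_rcons.
pose F' s := \sum_(r <- allseqs states n) row_product k.+1 s r * F (map snd r).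
transitivity (\sum_(l <- allseqs (allseqs states n) k.+1)
     (\prod_(y < k.+1) row_product y (map snd (nth [::] l y.-1)) (nth [::] l y)) *
     F' (map snd (nth [::] l k))).
  apply: eq_big_seq => l; rewrite mem_allseqs => /andP[/eqP sl _].
  rewrite mulr_sumr; apply: eq_bigr => r _; rewrite big_ord_recr /=.
  rewrite !nth_rcons sl ltnn ltnSn eqxx mulrA; congr (_ * _ * _).
  apply: eq_bigr => y _; rewrite !nth_rcons sl ltn_ord.
  by rewrite (leq_ltn_trans (leq_pred y) (ltn_ord y)).
rewrite IH; last exact: ltnW.
transitivity (sumbits k.+1 (fun s => path_weight t a k.+1 s * sumbits k.+2 (fun s' =>
   row_weight t (a k.+1) (mkseq a k.+1) true s s' * F (s' ++ nseq (n - k.+2) false)))).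
  apply: eq_sumbits => s sz; congr (_ * _).
  have := @sum_vertex_weight n (mkseq a k.+1) (a k.+1) true (s ++ nseq (n - k.+1) false) F.
  by rewrite size_mkseq take_size_cat // => <- //; rewrite size_cat sz leq_addr.
under eq_sumbits do rewrite mulr_sumbits.
rewrite exchange_sumbits; apply: eq_sumbits => s' _.
rewrite -[path_weight t a k.+2 s']/(sumbits k.+1 (fun s0 =>
  path_weight t a k.+1 s0 * row_weight t (a k.+1) (mkseq a k.+1) true s0 s')).
by rewrite mulr_sumbitsl; apply: eq_sumbits => s _; rewrite mulrA.
Qed.

End SixVertexRows.

(** * Configurations as stacks of rows *)

Section Configurations.
Variables (R : realType) (t : R) (n : nat) (a : 'I_n -> R).

Let void : bool * bool := (false, false).

Definition config_rows (C : config n) : seq (seq (bool * bool)) :=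
  [seq [seq C (x, y) | x <- enum 'I_n] | y <- enum 'I_n].

Lemma outgoing_config_rows (C : config n) x y :
  outgoing C x y = nth void (nth [::] (config_rows C) y) x.
Proof.
have sC : size (config_rows C) = n by rewrite size_map size_enum_ord.
have out_y : (n <= y)%N -> nth void (nth [::] (config_rows C) y) x = void.
  by move=> ny; rewrite [nth [::] _ _]nth_default ?sC // nth_nil.
rewrite /outgoing; case: insubP => [i _ <-|xn]; last first.
  have [yn|/out_y -> //] := ltnP y n.
  rewrite (nth_map (Ordinal yn)) ?size_enum_ord // nth_default //.
  by rewrite size_map size_enum_ord leqNgt.
case: insubP => [j _ <-|]; last by rewrite -leqNgt => ny; rewrite [nth [::] _ _]nth_default ?sC // nth_nil.
rewrite /config_rows (nth_map (j : 'I_n)) ?size_enum_ord ?ltn_ord // nth_ord_enum.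
by rewrite (nth_map (i : 'I_n)) ?size_enum_ord ?ltn_ord // nth_ord_enum.
Qed.

Lemma size_config_rows (C : config n) : size (config_rows C) = n.
Proof. by rewrite size_map size_enum_ord. Qed.

Lemma size_config_row (C : config n) y : (y < n)%N -> size (nth [::] (config_rows C) y) = n.
Proof.
move=> yn; have yn' : (y < size (enum 'I_n))%N by rewrite size_enum_ord.
by rewrite (nth_map (Ordinal yn) [::] _ yn') size_map size_enum_ord.
Qed.

Lemma config_rows_inj : injective config_rows.
Proof.
move=> C D E; apply/ffunP => -[x y].
have out (B : config n) : B (x, y) = outgoing B x y by rewrite /outgoing !valK.
by rewrite !out !outgoing_config_rows E.
Qed.

Lemma big_config (F : seq (seq (bool * bool)) -> R) :
  \sum_(C : config n) F (config_rows C) =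
  \sum_(l <- allseqs (allseqs states n) n) F l.
Proof.
rewrite -(big_map config_rows xpredT F); apply: perm_big; apply: uniq_perm.
- by rewrite map_inj_uniq ?index_enum_uniq //; apply: config_rows_inj.
- by rewrite allseqs_uniq // allseqs_uniq // enum_uniq.
move=> l; rewrite mem_allseqs; apply/mapP/andP => [[C _ ->]|[/eqP ln /allP lrows]].
  split; first by rewrite size_map size_enum_ord.
  apply/allP => _ /mapP[y _ ->] /=; rewrite mem_allseqs size_map size_enum_ord eqxx.
  by apply/allP => z _ /=; rewrite mem_enum.
exists [ffun p : 'I_n * 'I_n => nth void (nth [::] l p.2) p.1].
  by rewrite mem_index_enum.
apply: (@eq_from_nth _ [::]); rewrite ?size_config_rows ln // => y yn.
have : nth [::] l y \in allseqs states n by apply: lrows; rewrite mem_nth ?ln.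
rewrite mem_allseqs => /andP[/eqP sy _].
apply: (@eq_from_nth _ void).
  by rewrite sy size_config_row.
move=> x; rewrite sy => xn; rewrite -outgoing_config_rows /outgoing.
by rewrite !insubT /= ffunE.
Qed.

(** The indicator of well-formedness and the corner factors are spread over all vertices of the
    square; the cases left of, at and beyond the corner are then those of [vertex_weight]. *)
Lemma config_weight_rows (b : nat -> R) (C : config n) : (forall i : 'I_n, b i = a i) ->
  (well_formed C)%:R * config_weight t a C =
  \prod_(y < n) row_product t b n y (map snd (nth [::] (config_rows C) y.-1))
                                    (nth [::] (config_rows C) y).
Proof.
move=> ba; rewrite /config_weight /row_product.
pose w (x y : nat) := west C x y.
transitivity (\prod_(y < n) \prod_(x < n)
   ((((y <= x)%N ==> ~~ (C (x, y)).1) && ((y < x)%N ==> ~~ (C (x, y)).2))%:R *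
    ((if (x < y)%N then bulk_weight t (a x * a y) (west C x y) (south C x y)
         (east C x y) (north C x y) else 1) *
     (if x == y then corner_weight (west C x x) (north C x x) else 1)))).
  under [RHS]eq_bigr do rewrite big_split /=; rewrite big_split /=; congr (_ * _).
    rewrite exchange_big pair_bigA /=.
    rewrite (eq_bigr (fun v : 'I_n * 'I_n => (((v.2 <= v.1)%N ==> ~~ (C v).1) &&
                           ((v.2 < v.1)%N ==> ~~ (C v).2))%:R)); last by case.
    rewrite /well_formed; case: forallP => [wf|nwf].
      by rewrite big1 // => v _; rewrite wf.
    have [v nv] : exists v : 'I_n * 'I_n, ~~ (((v.2 <= v.1)%N ==> ~~ (C v).1) &&
                           ((v.2 < v.1)%N ==> ~~ (C v).2)).
      by apply/existsP; rewrite -negb_forall; apply/forallP.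
    by rewrite (bigD1 v) //= (negPf nv) mul0r.
  under [RHS]eq_bigr do rewrite big_split /=; rewrite big_split /=; congr (_ * _).
    exact: (prod_ltn_pairs (fun x y : 'I_n => bulk_weight t (a x * a y) (west C x y)
      (south C x y) (east C x y) (north C x y))).
  apply: eq_bigr => y _; rewrite (bigD1 y) //= eqxx big1 ?mulr1 // => x /negPf xy.
  by rewrite xy.
apply: eq_bigr => y _; apply: eq_bigr => x _.
rewrite /vertex_weight size_mkseq.
have CE : C (x, y) = nth void (nth [::] (config_rows C) y) x.
  by rewrite -outgoing_config_rows /outgoing !valK.
have wE : west C x y = west_of true (nth [::] (config_rows C) y) x.
  rewrite /west /west_of; case: (val x) => // x'.
  by rewrite /east outgoing_config_rows.
have sE : south C x y = nth false (map snd (nth [::] (config_rows C) y.-1)) x.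
  rewrite /south /north outgoing_config_rows.
  set r := nth [::] _ _; have [xr|rx] := ltnP x (size r).
    by rewrite (nth_map void).
  by rewrite !nth_default ?size_map.
rewrite wE sE /east /north !outgoing_config_rows CE -/void.
case: ltngtP => [yx|xy|/val_inj yx] /=.
- by rewrite ifF ?mulr1 //; apply/eqP => E; rewrite E ltnn in yx.
- rewrite nth_mkseq // !ba ifF ?mulr1 ?mul1r //.
  by apply/eqP => E; rewrite E ltnn in xy.
- by subst y; rewrite eqxx andbT mul1r wE mulrC.
Qed.

Lemma sixvertex_prob_path_weight (b : nat -> R) (s : 'I_n -> bool) : (0 < n)%N ->
    (forall i : 'I_n, b i = a i) ->
  sixvertex_prob t a [pred C : config n | path_string C == [ffun k : 'I_n => s k]]
  = path_weight t b n (mkseq (fun i => oapp s false (insub i)) n).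
Proof.
move=> n0 ba; set u := mkseq _ n; have sz : size u = n by rewrite size_mkseq.
have pathE C : (path_string C == [ffun k : 'I_n => s k]) =
    (map snd (nth [::] (config_rows C) n.-1) == u).
  have n1 : (n.-1 < n)%N by rewrite prednK.
  have szr : size (nth [::] (config_rows C) n.-1) = n by rewrite size_config_row.
  have nthE (i : 'I_n) : north C i n.-1 =
      nth false (map snd (nth [::] (config_rows C) n.-1)) i.
    by rewrite /north outgoing_config_rows (nth_map void) ?szr.
  apply/eqP/eqP => [/ffunP E|E].
    apply: (@eq_from_nth _ false) => [|i]; rewrite size_map szr // => ilt.
    have := E (Ordinal ilt); rewrite !ffunE nthE /= => ->.
    by rewrite /u nth_mkseq // insubT.
  by apply/ffunP => i; rewrite !ffunE nthE E /u nth_mkseq // valK.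
rewrite /sixvertex_prob big_mkcond /=.
pose F l := (\prod_(y < n) row_product t b n y (map snd (nth [::] l y.-1)) (nth [::] l y)) *
     (map snd (nth [::] l n.-1) == u)%:R.
transitivity (\sum_(C : config n) F (config_rows C)).
  apply: eq_bigr => C _; rewrite /F -config_weight_rows // -pathE.
  by case: (well_formed C); case: eqP; rewrite /= ?mul1r ?mulr1 ?mul0r ?mulr0.
rewrite big_config /F.
have := @sum_rows R t b n n.-1 (fun v => (v == u)%:R).
rewrite prednK // leqnn => /(_ isT) ->.
rewrite (eq_sumbits (G := fun s => if s == u then path_weight t b n s else 0)).
  by rewrite sumbits_pred1.
by move=> s' sz'; rewrite subnn cats0; case: eqP; rewrite ?mulr1 ?mulr0.
Qed.

End Configurations.

Theorem theorem4p4 (R : realType) (n : nat) (t : R) (a : 'I_n -> R)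
    (hn : (0 < n)%N) (ht : 0 <= t < 1) (ha : forall i : 'I_n, 0 < a i < 1)
    (s : 'I_n -> bool) :
  HL_prob t a [set lam : chain n | length_increments lam = [ffun i : 'I_n => nat_of_bool (s i)]]
  = (sixvertex_prob t a [pred C : config n | path_string C == [ffun k : 'I_n => s k]])%:E.
Proof.
rewrite (HL_prob_path_weight ht ha) (sixvertex_prob_path_weight t (b := extend_param a)) //.
exact: extend_paramE.
Qed.
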